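(* Let $\Lambda$ be a self-injective artin algebra, let $n>1$ be an integer and let $\mathcal{M}$ be an $n$-cluster tilting subcategory of $\mathrm{mod}\text{-}\Lambda$. The functor $\Phi=i_\lambda|\circ\Upsilon:\mathcal{S}(\mathcal{M})\to\mathrm{mod}\text{-}\underline{\mathcal{M}}$ is full, dense and objective.
   Context: $\mathrm{mod}\text{-}\Lambda$ is the category of finitely generated $\Lambda$-modules; all subcategories are full. A full additive subcategory $\mathcal{M}$ of $\mathrm{mod}\text{-}\Lambda$ is $n$-cluster tilting if it is functorially finite (every module has a right and a left $\mathcal{M}$-approximation), generating-cogenerating (every module is a quotient of an object of $\mathcal{M}$ and embeds in an object of $\mathcal{M}$), and $$\mathcal{M}=\{A: \mathrm{Ext}^i_\Lambda(\mathcal{M},A)=0,\ 0<i<n\}=\{A: \mathrm{Ext}^i_\Lambda(A,\mathcal{M})=0,\ 0<i<n\}.$$ $\mathcal{S}(\mathcal{M})$ is the category whose objects are monomorphisms $f:M_1\to M_2$ of $\Lambda$-modules with $M_1,M_2\in\mathcal{M}$, and whose morphisms are commutative squares. $\mathcal{M}(-,M)=\mathrm{Hom}_\Lambda(-,M)|_{\mathcal{M}}$. $\mathrm{mod}\text{-}\mathcal{M}$ is the category of finitely presented additive contravariant functors $\mathcal{M}\to\mathrm{Ab}$, $\widetilde{\mathcal{P}}^{\leqslant 1}(\mathcal{M})$ is its full subcategory of functors of projective dimension at most one, and $\mathrm{mod}\text{-}\underline{\mathcal{M}}$ is its full subcategory of functors vanishing on projective $\Lambda$-modules (equivalently, the finitely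 presented additive contravariant functors on the stable category $\underline{\mathcal{M}}$, i.e. $\mathcal{M}$ modulo morphisms factoring through projective $\Lambda$-modules). The functor $\Upsilon:\mathcal{S}(\mathcal{M})\to\widetilde{\mathcal{P}}^{\leqslant 1}(\mathcal{M})$ is $(M_1\xrightarrow{f}M_2)\mapsto\mathrm{Coker}(\mathcal{M}(-,M_1)\xrightarrow{\mathcal{M}(-,f)}\mathcal{M}(-,M_2))$. The functor $i_\lambda:\mathrm{mod}\text{-}\mathcal{M}\to\mathrm{mod}\text{-}\underline{\mathcal{M}}$ is the left adjoint of the inclusion; explicitly, for $F\in\mathrm{mod}\text{-}\mathcal{M}$ with minimal projective presentation $\mathcal{M}(-,M^1)\to\mathcal{M}(-,M^0)\to F\to 0$, put $\vartheta(F)=\mathrm{Coker}(M^1\to M^0)$, take a minimal projective presentation $P\to Q\to\vartheta(F)\to 0$ in $\mathrm{mod}\text{-}\Lambda$, put $\vartheta_\lambda\vartheta(F)=\mathrm{Coker}(\mathcal{M}(-,P)\to\mathcal{M}(-,Q))$, lift the identity of $\vartheta(F)$ to maps $P\to M^1$, $Q\to M^0$, and let $\eta_F:\vartheta_\lambda\vartheta(F)\to F$ be the induced map; then $i_\lambda(F)=\mathrm{Coker}(\eta_F)$. $i_\lambda|$ denotes the restriction of $i_\lambda$ to $\widetilde{\mathcal{P}}^{\leqslant 1}(\mathcal{M})$. An additive functor $F:\mathcal{X}\to\mathcal{Y}$ between additive categories is objective if every morphism $f$ in $\mathcal{X}$ with $F(f)=0$ factors through an object $K$ with $F(K)=0$.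 *)

(* Defs.v *)
From HB Require Import structures.
From mathcomp Require Import all_boot all_algebra.
From mathcomp Require Import generic_quotient ring_quotient boolp.

Set Implicit Arguments.
Unset Strict Implicit.
Unset Printing Implicit Defensive.

Import GRing.Theory.
Local Open Scope ring_scope.

Section Modules.
Variable R : nzRingType.

Definition fin_gen (V : lmodType R) : Prop :=
  exists (m : nat) (e : 'I_m -> V),
    forall v, exists c : 'I_m -> R, v = \sum_(i < m) c i *: e i.

Definition surj (A B : Type) (f : A -> B) : Prop := forall y, exists x, f x = y.

Definition proj_module (P : lmodType R) : Prop :=
  forall (A B : lmodType R) (e : {linear A -> B}) (f : {linear P -> B}),
    surj e -> exists g : {linear P -> A}, forall x, e (g x) = f x.

Definition inj_module (I : lmodType R) : Prop :=
  forall (A B : lmodType R) (m : {linear A -> B}) (f : {linear A -> I}),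
    injective m -> exists g : {linear B -> I}, forall x, g (m x) = f x.

Record proj_resolution (A : lmodType R) := ProjResolution {
  res :> nat -> lmodType R;
  res_d : forall i, {linear res i.+1 -> res i};
  res_aug : {linear res 0 -> A};
  res_proj : forall i, proj_module (res i);
  res_surj : surj res_aug;
  res_exact0 : forall x, res_aug x = 0 <-> exists y, res_d 0 y = x;
  res_exact : forall i x, res_d i x = 0 <-> exists y, res_d i.+1 y = x }.

(** Vanishing of Ext^i(A, B), the i-th cohomology of Hom(P, B) for a projective
    resolution P of A; this group does not depend on the choice of P. *)
Definition Ext_vanishes (i : nat) (A B : lmodType R) : Prop :=
  forall P : proj_resolution A,
    match i with
    | 0 => forall f : {linear P 0 -> B},
        (forall x, f (res_d P 0 x) = 0) -> forall x, f x = 0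
    | j.+1 => forall f : {linear P j.+1 -> B},
        (forall x, f (res_d P j.+1 x) = 0) ->
        exists g : {linear P j -> B}, forall x, g (res_d P j x) = f x
    end.

(** The objects of mod-R, with left R-modules throughout. *)
Record fgMod := FgMod { fg_sort :> lmodType R; fgP : fin_gen fg_sort }.

End Modules.

Definition artinian (k : comNzRingType) : Prop :=
  forall I : nat -> k -> Prop,
    (forall i, [/\ I i 0, forall x y, I i x -> I i y -> I i (x + y)
                 & forall a x, I i x -> I i (a * x)]) ->
    (forall i x, I i.+1 x -> I i x) ->
    exists N, forall i x, (N <= i)%N -> I N x -> I i x.

Definition artin_algebra (k : comNzRingType) (L : algType k) : Prop :=
  artinian k /\ fin_gen (L : lmodType k).

Definition self_injective (L : nzRingType) : Prop := inj_module (L^o : lmodType L).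

Section LinearMaps.
Variables (R : nzRingType) (U V : lmodType R).

Lemma linear_ext (f g : {linear U -> V}) : f =1 g -> f = g.
Proof.
move: f g => [f [[cf] [df]]] [g [[cg] [dg]]] /= /funext fg.
rewrite /= in fg; subst g; congr (GRing.Linear.Pack (GRing.Linear.Class _ _));
  congr (_ _); exact: Prop_irrelevance.
Qed.

HB.instance Definition _ := gen_eqMixin {linear U -> V}.
HB.instance Definition _ := gen_choiceMixin {linear U -> V}.

Definition lin0 : {linear U -> V} := \0.
Definition linD (f g : {linear U -> V}) : {linear U -> V} := f \+ g.
Definition linN (f : {linear U -> V}) : {linear U -> V} := \- f.

Lemma linDA : associative linD.
Proof. by move=> f g h; apply: linear_ext => x /=; rewrite addrA. Qed.
Lemma linDC : commutative linD.
Proof. by move=> f g; apply: linear_ext => x /=; rewrite addrC. Qed.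
Lemma lin0D : left_id lin0 linD.
Proof. by move=> f; apply: linear_ext => x /=; rewrite add0r. Qed.
Lemma linND : left_inverse lin0 linN linD.
Proof. by move=> f; apply: linear_ext => x /=; rewrite addNr. Qed.
HB.instance Definition _ :=
  GRing.isZmodule.Build {linear U -> V} linDA linDC lin0D linND.
End LinearMaps.

Section Subgroups.
Variables (V : zmodType) (P : V -> Prop).
Hypotheses (P0 : P 0) (PB : forall x y, P x -> P y -> P (x - y)).

Definition prop_pred : {pred V} := fun x => `[< P x >].

Lemma prop_pred_closed : zmod_closed prop_pred.
Proof.
split=> [|x y /asboolP Px /asboolP Py]; apply/asboolP => //; exact: PB.
Qed.

Definition zmod_pred : zmodClosed V :=
  HB.pack_for (zmodClosed V) prop_pred
    (GRing.isZmodClosed.Build V prop_pred prop_pred_closed).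

Lemma zmod_predP x : x \in zmod_pred <-> P x.
Proof. by split=> [/asboolP|Px]; last exact/asboolP. Qed.
End Subgroups.

Section QuotientGroups.
Variables (V : zmodType) (I : zmodClosed V).

Definition qpi (x : V) : {ideal_quot I} := (\pi x)%qT.

Lemma qpi_additive : zmod_morphism qpi.
Proof.
move=> x y; rewrite /qpi.
by rewrite (Quotient.pi_add I x (- y)) (Quotient.pi_opp I y).
Qed.
HB.instance Definition _ := GRing.isZmodMorphism.Build V {ideal_quot I} qpi
  qpi_additive.

Lemma qpi_eq0 x : qpi x = 0 <-> x \in I.
Proof.
have -> : 0 = qpi 0 by rewrite raddf0.
rewrite -[x in x \in I]subr0 Quotient.idealrBE.
by split=> /eqP.
Qed.

Lemma qpi_surj y : exists x, qpi x = y.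
Proof. by exists (repr y); rewrite /qpi reprK. Qed.

Lemma qpi_eq x y : qpi x = qpi y <-> x - y \in I.
Proof.
split=> [xy|/qpi_eq0/eqP].
  by apply/qpi_eq0; rewrite raddfB /= xy subrr.
by rewrite raddfB subr_eq0 => /eqP.
Qed.

End QuotientGroups.

Section QuotientMaps.
Variables (V W : zmodType) (I : zmodClosed V) (J : zmodClosed W).
Variables (f : {additive V -> W}) (fIJ : forall x, x \in I -> f x \in J).

Definition qmap_fun (y : {ideal_quot I}) : {ideal_quot J} := qpi J (f (repr y)).

Lemma qmap_funE x : qmap_fun (qpi I x) = qpi J (f x).
Proof.
apply/qpi_eq; rewrite -raddfB; apply/fIJ/qpi_eq.
by rewrite /qpi reprK.
Qed.

Lemma qmap_additive : zmod_morphism qmap_fun.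
Proof.
move=> u v; have [x <-] := qpi_surj u; have [y <-] := qpi_surj v.
by rewrite -raddfB !qmap_funE !raddfB.
Qed.
HB.instance Definition _ :=
  GRing.isZmodMorphism.Build {ideal_quot I} {ideal_quot J} qmap_fun
    qmap_additive.

Definition qmap : {additive {ideal_quot I} -> {ideal_quot J}} := qmap_fun.

Lemma qmapE x : qmap (qpi I x) = qpi J (f x).
Proof. exact: qmap_funE. Qed.

End QuotientMaps.

Section ClusterTilting.
Variables (R : nzRingType) (M : fgMod R -> Prop).

Record additive_subcat : Prop := {
  add_zero : exists2 Z : fgMod R, M Z & forall z : Z, z = 0;
  (* the case of a zero module Y makes M closed under isomorphism *)
  add_sum : forall X Y Z : fgMod R, M X -> M Y ->
    (exists h : {linear Z -> (X * Y)%type}, bijective h) -> M Z }.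

Definition right_approx (A X : fgMod R) (f : {linear X -> A}) : Prop :=
  M X /\ forall Y : fgMod R, M Y -> forall g : {linear Y -> A},
    exists h : {linear Y -> X}, forall y, f (h y) = g y.

Definition left_approx (A X : fgMod R) (f : {linear A -> X}) : Prop :=
  M X /\ forall Y : fgMod R, M Y -> forall g : {linear A -> Y},
    exists h : {linear X -> Y}, forall a, h (f a) = g a.

Record cluster_tilting (n : nat) : Prop := {
  ct_additive : additive_subcat;
  ct_contravariantly_finite :
    forall A : fgMod R, exists (X : fgMod R) (f : {linear X -> A}), right_approx f;
  ct_covariantly_finite :
    forall A : fgMod R, exists (X : fgMod R) (f : {linear A -> X}), left_approx f;
  ct_generating : forall A : fgMod R,
    exists X : fgMod R, M X /\ exists f : {linear X -> A}, surj f;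
  ct_cogenerating : forall A : fgMod R,
    exists X : fgMod R, M X /\ exists f : {linear A -> X}, injective f;
  ct_right_perp : forall A : fgMod R,
    M A <-> forall X : fgMod R, M X ->
            forall i, (0 < i < n)%N -> Ext_vanishes i X A;
  ct_left_perp : forall A : fgMod R,
    M A <-> forall X : fgMod R, M X ->
            forall i, (0 < i < n)%N -> Ext_vanishes i A X }.

End ClusterTilting.

(** Morphism groups are presented by their operations rather than as a
    [zmodType]: natural transformations between functors on a category of modules
    live in too large a universe to form a [zmodType]. *)
Record preadditive := Preadditive {
  obj :> Type;
  hom : obj -> obj -> Type;
  idm : forall X, hom X X;
  compm : forall X Y Z, hom Y Z -> hom X Y -> hom X Z;
  hom0 : forall X Y, hom X Y;
  homD : forall X Y, hom X Y -> hom X Y -> hom X Y;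
  homN : forall X Y, hom X Y -> hom X Y;
  compmA : forall W X Y Z (h : hom Y Z) (g : hom X Y) (f : hom W X),
    compm h (compm g f) = compm (compm h g) f;
  comp1m : forall X Y (f : hom X Y), compm (idm Y) f = f;
  compm1 : forall X Y (f : hom X Y), compm f (idm X) = f;
  homDA : forall X Y, associative (@homD X Y);
  homDC : forall X Y, commutative (@homD X Y);
  hom0D : forall X Y, left_id (hom0 X Y) (@homD X Y);
  homND : forall X Y, left_inverse (hom0 X Y) (@homN X Y) (@homD X Y);
  compmDl : forall X Y Z (g h : hom Y Z) (f : hom X Y),
    compm (homD g h) f = homD (compm g f) (compm h f);
  compmDr : forall X Y Z (h : hom Y Z) (f g : hom X Y),
    compm h (homD f g) = homD (compm h f) (compm h g) }.

Arguments hom {p}.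
Arguments idm {p}.
Arguments compm {p X Y Z}.
Arguments hom0 {p X Y}.
Arguments homD {p X Y}.
Arguments homN {p X Y}.

Record functor (C D : preadditive) := Functor {
  fobj :> C -> D;
  fmap : forall X Y, hom X Y -> hom (fobj X) (fobj Y);
  fmap1 : forall X, fmap (idm X) = idm (fobj X);
  fmapM : forall X Y Z (g : hom Y Z) (f : hom X Y),
    fmap (compm g f) = compm (fmap g) (fmap f);
  fmapD : forall X Y (f g : hom X Y), fmap (homD f g) = homD (fmap f) (fmap g) }.

Arguments fmap {C D} _ {X Y}.

Section CategoryNotions.
Variables C D : preadditive.

Definition isomorphic (X Y : C) : Prop :=
  exists (f : hom X Y) (g : hom Y X), compm g f = idm X /\ compm f g = idm Y.

Definition zero_object (X : C) : Prop :=
  forall Y, (forall f : hom X Y, f = hom0) /\ (forall f : hom Y X, f = hom0).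

Definition left_adjoint (F : functor C D) (G : functor D C) : Prop :=
  exists phi : forall X Y, hom (F X) Y -> hom X (G Y),
    (forall X Y, bijective (phi X Y)) /\
    forall X' X Y Y' (f : hom X' X) (g : hom Y Y') (h : hom (F X) Y),
      phi X' Y' (compm g (compm h (fmap F f))) =
      compm (fmap G g) (compm (phi X Y h) f).

End CategoryNotions.

Section FunctorNotions.
Variables (C D : preadditive) (F : functor C D).

Definition full : Prop :=
  forall (X Y : C) (g : hom (F X) (F Y)), exists f : hom X Y, fmap F f = g.

Definition dense : Prop := forall Y : D, exists X : C, isomorphic (F X) Y.

Definition objective : Prop :=
  forall (X Y : C) (f : hom X Y), fmap F f = hom0 ->
    exists (K : C) (g : hom X K) (h : hom K Y),
      f = compm h g /\ zero_object (F K).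

End FunctorNotions.

Section CompFunctor.
Variables (C D E : preadditive) (G : functor D E) (F : functor C D).

Lemma comp_fmap1 X : fmap G (fmap F (idm X)) = idm (G (F X)).
Proof. by rewrite !fmap1. Qed.
Lemma comp_fmapM X Y Z (g : hom Y Z) (f : hom X Y) :
  fmap G (fmap F (compm g f)) = compm (fmap G (fmap F g)) (fmap G (fmap F f)).
Proof. by rewrite !fmapM. Qed.
Lemma comp_fmapD X Y (f g : hom X Y) :
  fmap G (fmap F (homD f g)) = homD (fmap G (fmap F f)) (fmap G (fmap F g)).
Proof. by rewrite !fmapD. Qed.

Definition comp_functor : functor C E :=
  @Functor C E (fun X => G (F X)) (fun X Y f => fmap G (fmap F f))
    comp_fmap1 comp_fmapM comp_fmapD.

End CompFunctor.

Section FullSubcategory.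
Variables (C : preadditive) (P : C -> Prop).

Record subobj := SubObj { subval : C; subvalP : P subval }.

Definition full_sub : preadditive := {|
  obj := subobj;
  hom := fun X Y => hom (subval X) (subval Y);
  idm := fun X => idm (subval X);
  compm := fun X Y Z => @compm C (subval X) (subval Y) (subval Z);
  hom0 := fun X Y => @hom0 C (subval X) (subval Y);
  homD := fun X Y => @homD C (subval X) (subval Y);
  homN := fun X Y => @homN C (subval X) (subval Y);
  compmA := fun W X Y Z => @compmA C _ _ _ _;
  comp1m := fun X Y => @comp1m C _ _;
  compm1 := fun X Y => @compm1 C _ _;
  homDA := fun X Y => @homDA C _ _;
  homDC := fun X Y => @homDC C _ _;
  hom0D := fun X Y => @hom0D C _ _;
  homND := fun X Y => @homND C _ _;
  compmDl := fun X Y Z => @compmDl C _ _ _;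
  compmDr := fun X Y Z => @compmDr C _ _ _ |}.

Definition incl : functor full_sub C :=
  @Functor full_sub C subval (fun X Y f => f)
    (fun=> erefl) (fun _ _ _ _ _ => erefl) (fun _ _ _ _ => erefl).

End FullSubcategory.

Section FunctorsOnM.
Variables (R : nzRingType) (M : fgMod R -> Prop).

Record objM := ObjM { modM :> fgMod R; modMP : M modM }.

Record presheaf := Presheaf {
  pobj :> objM -> zmodType;
  pmap : forall X Y : objM, {linear X -> Y} -> {additive pobj Y -> pobj X};
  pmap1 : forall (X : objM) x, pmap (idfun : {linear X -> X}) x = x;
  pmapM : forall (X Y Z : objM) (g : {linear Y -> Z}) (f : {linear X -> Y}) x,
    pmap (g \o f : {linear X -> Z}) x = pmap f (pmap g x);
  pmapD : forall (X Y : objM) (f g : {linear X -> Y}) x,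
    pmap (f + g) x = pmap f x + pmap g x }.

Arguments pmap p {X Y}.

Record nattrans (F G : presheaf) := NatTrans {
  ncomp :> forall X, {additive F X -> G X};
  ncompP : forall (X Y : objM) (f : {linear X -> Y}) x,
    ncomp X (pmap F f x) = pmap G f (ncomp Y x) }.

Lemma additive_ext (U V : zmodType) (f g : {additive U -> V}) : f =1 g -> f = g.
Proof.
move: f g => [f [[cf]]] [g [[cg]]] /= /funext fg.
rewrite /= in fg; subst g; congr (GRing.Additive.Pack (GRing.Additive.Class _));
  congr (_ _); exact: Prop_irrelevance.
Qed.

Lemma nattrans_ext F G (a b : nattrans F G) :
  (forall X x, a X x = b X x) -> a = b.
Proof.
move=> ab; have : ncomp a = ncomp b.
  by apply: functional_extensionality_dep => X; apply: additive_ext => x.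
move: a b {ab} => [a na] [b nb] /= ab; subst b.
by congr NatTrans; exact: Prop_irrelevance.
Qed.

Section NatOps.
Variables F G H : presheaf.
Implicit Types a b : nattrans F G.

Definition nat1 : nattrans F F :=
  @NatTrans F F (fun X => idfun) (fun _ _ _ _ => erefl).

Lemma natM_nat (c : nattrans G H) a (X Y : objM) (f : {linear X -> Y}) x :
  (c X \o a X) (pmap F f x) = pmap H f ((c Y \o a Y) x).
Proof. by rewrite /= !ncompP. Qed.
Definition natM c a : nattrans F H := NatTrans (@natM_nat c a).

Lemma nat0_nat (X Y : objM) (f : {linear X -> Y}) x :
  (\0 : {additive F X -> G X}) (pmap F f x) =
  pmap G f ((\0 : {additive F Y -> G Y}) x).
Proof. by rewrite /= raddf0. Qed.
Definition nat0 : nattrans F G := NatTrans nat0_nat.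

Lemma natD_nat a b (X Y : objM) (f : {linear X -> Y}) x :
  (a X \+ b X) (pmap F f x) = pmap G f ((a Y \+ b Y) x).
Proof. by rewrite /= !ncompP raddfD. Qed.
Definition natD a b : nattrans F G := NatTrans (@natD_nat a b).

Lemma natN_nat a (X Y : objM) (f : {linear X -> Y}) x :
  (\- a X) (pmap F f x) = pmap G f ((\- a Y) x).
Proof. by rewrite /= !ncompP raddfN. Qed.
Definition natN a : nattrans F G := NatTrans (@natN_nat a).
End NatOps.

Program Definition presheaf_cat : preadditive := {|
  obj := presheaf; hom := nattrans; idm := nat1; compm := natM;
  hom0 := nat0; homD := natD; homN := natN |}.
Next Obligation. by apply: nattrans_ext. Qed.
Next Obligation. by apply: nattrans_ext. Qed.
Next Obligation. by apply: nattrans_ext. Qed.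
Next Obligation.
by move=> a b c; apply: nattrans_ext => Z z /=; rewrite addrA.
Qed.
Next Obligation.
by move=> a b; apply: nattrans_ext => Z z /=; rewrite addrC.
Qed.
Next Obligation.
by move=> a; apply: nattrans_ext => Z z /=; rewrite add0r.
Qed.
Next Obligation.
by move=> a; apply: nattrans_ext => Z z /=; rewrite addNr.
Qed.
Next Obligation. by apply: nattrans_ext. Qed.
Next Obligation. by apply: nattrans_ext => W w /=; rewrite raddfD. Qed.

(** Quotients and cokernels in the functor category are computed objectwise. *)
Record subpresheaf (F : presheaf) := SubPresheaf {
  sub_pred :> forall X : objM, zmodClosed (F X);
  sub_stable : forall (X Y : objM) (f : {linear X -> Y}) x,
    x \in sub_pred Y -> pmap F f x \in sub_pred X }.

Section QuotientPresheaf.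
Variables (F : presheaf) (S : subpresheaf F).

Definition quot_pobj (X : objM) : zmodType := {ideal_quot (S X)}.

Definition quot_pmap (X Y : objM) (f : {linear X -> Y}) :
  {additive quot_pobj Y -> quot_pobj X} :=
  qmap (@sub_stable F S X Y f).

Lemma quot_pmap1 (X : objM) x : quot_pmap (idfun : {linear X -> X}) x = x.
Proof.
have [y <-] := qpi_surj x; rewrite [LHS]qmapE; congr (qpi _ _); exact: pmap1.
Qed.

Lemma quot_pmapM (X Y Z : objM) (g : {linear Y -> Z}) (f : {linear X -> Y}) x :
  quot_pmap (g \o f : {linear X -> Z}) x = quot_pmap f (quot_pmap g x).
Proof.
have [y <-] := qpi_surj x; rewrite /quot_pmap !(qmapE _ y) qmapE; congr (qpi _ _).
exact: pmapM.
Qed.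

Lemma quot_pmapD (X Y : objM) (f g : {linear X -> Y}) x :
  quot_pmap (f + g) x = quot_pmap f x + quot_pmap g x.
Proof.
have [y <-] := qpi_surj x; rewrite /quot_pmap !qmapE -raddfD.
congr (qpi _ _); exact: pmapD.
Qed.

Definition quot_presheaf : presheaf :=
  Presheaf quot_pmap1 quot_pmapM quot_pmapD.

Lemma quot_proj_nat (X Y : objM) (f : {linear X -> Y}) x :
  qpi (S X) (pmap F f x) = pmap quot_presheaf f (qpi (S Y) x).
Proof. exact/esym/qmapE. Qed.

Definition quot_proj : nattrans F quot_presheaf :=
  @NatTrans F quot_presheaf (fun X => qpi (S X)) quot_proj_nat.

End QuotientPresheaf.

Section QuotientPresheafMap.
Variables (F G : presheaf) (S : subpresheaf F) (T : subpresheaf G).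
Variables (a : nattrans F G) (aST : forall X x, x \in S X -> a X x \in T X).

Lemma quot_map_nat (X Y : objM) (f : {linear X -> Y}) x :
  qmap (@aST X) (pmap (quot_presheaf S) f x) =
  pmap (quot_presheaf T) f (qmap (@aST Y) x).
Proof.
have [y <-] := qpi_surj x; rewrite [pmap _ f _]qmapE (qmapE _ y) [RHS]qmapE [LHS]qmapE; congr (qpi _ _).
exact: ncompP.
Qed.

Definition quot_map : nattrans (quot_presheaf S) (quot_presheaf T) :=
  @NatTrans (quot_presheaf S) (quot_presheaf T) (fun X => qmap (@aST X))
    quot_map_nat.
End QuotientPresheafMap.

Section Cokernel.
Variables (F G : presheaf) (a : nattrans F G).

Definition image_pred (X : objM) : zmodClosed (G X).
Proof.
apply: (@zmod_pred _ (fun y => exists x, a X x = y)).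
  by exists 0; rewrite raddf0.
by move=> _ _ [x <-] [y <-]; exists (x - y); rewrite raddfB.
Defined.

Lemma image_stable (X Y : objM) (f : {linear X -> Y}) y :
  y \in image_pred Y -> pmap G f y \in image_pred X.
Proof.
move=> /zmod_predP[x <-]; apply/zmod_predP; exists (pmap F f x).
exact: ncompP.
Qed.

Definition image_sub : subpresheaf G := SubPresheaf image_stable.
Definition coker : presheaf := quot_presheaf image_sub.
Definition coker_proj : nattrans G coker := quot_proj image_sub.
End Cokernel.

Section CokernelMap.
Variables (F G F' G' : presheaf) (a : nattrans F G) (a' : nattrans F' G').
Variables (b : nattrans F F') (c : nattrans G G').
Hypothesis abc : natM c a = natM a' b.

Lemma coker_map_subproof (X : objM) x :
  x \in image_sub a X -> c X x \in image_sub a' X.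
Proof.
move=> /zmod_predP[y <-]; apply/zmod_predP; exists (b X y).
by move: (congr1 (fun n : nattrans _ _ => n X y) abc).
Qed.

Definition coker_map : nattrans (coker a) (coker a') :=
  quot_map coker_map_subproof.
End CokernelMap.

Section Yoneda.
Variable A : objM.

Definition yo_obj (X : objM) : zmodType := {linear X -> A}.

Definition yo_fun (X Y : objM) (f : {linear X -> Y}) (g : {linear Y -> A}) :
  {linear X -> A} := g \o f.

Lemma yo_additive (X Y : objM) (f : {linear X -> Y}) : zmod_morphism (yo_fun f).
Proof. by move=> g h; apply: linear_ext. Qed.
HB.instance Definition _ (X Y : objM) (f : {linear X -> Y}) :=
  GRing.isZmodMorphism.Build (yo_obj Y) (yo_obj X) (yo_fun f) (yo_additive f).

Definition yo_pmap (X Y : objM) (f : {linear X -> Y}) :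
  {additive yo_obj Y -> yo_obj X} := yo_fun f.

Lemma yo_pmap1 (X : objM) g : yo_pmap (idfun : {linear X -> X}) g = g.
Proof. exact: linear_ext. Qed.
Lemma yo_pmapM (X Y Z : objM) (g : {linear Y -> Z}) (f : {linear X -> Y}) h :
  yo_pmap (g \o f : {linear X -> Z}) h = yo_pmap f (yo_pmap g h).
Proof. exact: linear_ext. Qed.
Lemma yo_pmapD (X Y : objM) (f g : {linear X -> Y}) h :
  yo_pmap (f + g) h = yo_pmap f h + yo_pmap g h.
Proof. by apply: linear_ext => x /=; rewrite raddfD. Qed.

Definition yo : presheaf := Presheaf yo_pmap1 yo_pmapM yo_pmapD.

End Yoneda.

Section YonedaMap.
Variables (A B : objM) (u : {linear A -> B}).

Definition yo_map_fun (X : objM) (g : yo_obj A X) : yo_obj B X :=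
  (u \o (g : {linear X -> A}) : {linear X -> B}).

Lemma yo_map_additive X : zmod_morphism (@yo_map_fun X).
Proof. by move=> g h; apply: linear_ext => x /=; rewrite raddfB. Qed.
HB.instance Definition _ X := GRing.isZmodMorphism.Build
  (yo_obj A X) (yo_obj B X) (@yo_map_fun X) (@yo_map_additive X).

Lemma yo_map_nat (X Y : objM) (f : {linear X -> Y}) g :
  yo_map_fun (pmap (yo A) f g) = pmap (yo B) f (yo_map_fun g).
Proof. exact: linear_ext. Qed.

Definition yo_map : nattrans (yo A) (yo B) :=
  @NatTrans (yo A) (yo B) (fun X => @yo_map_fun X) yo_map_nat.
End YonedaMap.

Definition exact_at (F G H : presheaf) (a : nattrans F G) (b : nattrans G H) :=
  forall X (y : G X), b X y = 0 <-> exists x, a X x = y.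

Definition pointwise_inj (F G : presheaf) (a : nattrans F G) : Prop :=
  forall X, injective (a X).
Definition pointwise_surj (F G : presheaf) (a : nattrans F G) : Prop :=
  forall X, surj (a X).

Definition fin_pres (F : presheaf) : Prop :=
  exists (A1 A0 : objM) (a : nattrans (yo A1) (yo A0)) (p : nattrans (yo A0) F),
    exact_at a p /\ pointwise_surj p.

Definition mod_cat : preadditive := @full_sub presheaf_cat fin_pres.

(** Projective objects of the category of finitely presented functors, whose
    epimorphisms are the objectwise surjections: a cokernel computed objectwise
    is again finitely presented. *)
Definition proj_functor (P : presheaf) : Prop :=
  fin_pres P /\
  forall (F G : presheaf) (e : nattrans F G) (f : nattrans P G),
    fin_pres F -> fin_pres G -> pointwise_surj e ->
    exists g : nattrans P F, natM e g = f.

Definition pd_le1 (F : presheaf) : Prop :=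
  exists (P1 P0 : presheaf) (d : nattrans P1 P0) (p : nattrans P0 F),
    [/\ proj_functor P1, proj_functor P0, pointwise_inj d, exact_at d p
      & pointwise_surj p].

Definition pd1_cat : preadditive :=
  @full_sub mod_cat (fun F => pd_le1 (subval F)).

Definition vanishes_on_proj (F : presheaf) : Prop :=
  forall P : objM, proj_module P -> forall x : F P, x = 0.

Definition mod_stab_cat : preadditive :=
  @full_sub mod_cat (fun F => vanishes_on_proj (subval F)).

Lemma coker_exact (F G : presheaf) (a : nattrans F G) :
  exact_at a (coker_proj a) /\ pointwise_surj (coker_proj a).
Proof.
split=> X y; last exact: qpi_surj.
by apply: (iff_trans (qpi_eq0 _ _)); exact: zmod_predP.
Qed.

Lemma yo_ext (A : objM) (F : presheaf) (a b : nattrans (yo A) F) :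
  a A (idfun : {linear A -> A}) = b A (idfun : {linear A -> A}) -> a = b.
Proof.
move=> ab; apply: nattrans_ext => X g.
have -> : g = pmap (yo A) g (idfun : {linear A -> A}) by exact: linear_ext.
by rewrite !ncompP ab.
Qed.

Section YonedaLemma.
Variables (A : objM) (F : presheaf) (x : F A).
Definition yo_elt_fun (X : objM) (g : yo_obj A X) : F X := pmap F g x.
Lemma yo_elt_additive X : zmod_morphism (@yo_elt_fun X).
Proof.
move=> g h; rewrite /yo_elt_fun; apply/eqP; rewrite eq_sym subr_eq -pmapD.
by rewrite subrK.
Qed.
HB.instance Definition _ X := GRing.isZmodMorphism.Build
  (yo_obj A X) (F X) (@yo_elt_fun X) (@yo_elt_additive X).
Lemma yo_elt_nat (X Y : objM) (f : {linear X -> Y}) g :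
  yo_elt_fun (pmap (yo A) f g) = pmap F f (yo_elt_fun g).
Proof. exact: pmapM. Qed.
Definition yo_elt : nattrans (yo A) F :=
  @NatTrans (yo A) F (fun X => @yo_elt_fun X) yo_elt_nat.
Lemma yo_eltE : yo_elt A (idfun : {linear A -> A}) = x.
Proof. exact: pmap1. Qed.
End YonedaLemma.

Lemma yo_fin_pres (A : objM) : fin_pres (yo A).
Proof.
exists A, A, (nat0 _ _), (nat1 _); split=> X y; last by exists y.
by split=> [/= ->|[x /= <-]] //; exists 0.
Qed.

Lemma yo_proj (A : objM) : proj_functor (yo A).
Proof.
split=> [|F G e f _ _ eS]; first exact: yo_fin_pres.
have [x ex] := eS A (f A (idfun : {linear A -> A})).
by exists (yo_elt x); apply: yo_ext; rewrite /= [yo_elt_fun _ _]yo_eltE.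
Qed.

Record mono := Mono {
  mdom : objM;
  mcod : objM;
  mono_map :> {linear mdom -> mcod};
  monoP : injective mono_map }.

Record square (f g : mono) := Square {
  sq_dom : {linear mdom f -> mdom g};
  sq_cod : {linear mcod f -> mcod g};
  squareP : forall x, sq_cod (f x) = g (sq_dom x) }.

Lemma square_ext f g (s t : square f g) :
  sq_dom s = sq_dom t -> sq_cod s = sq_cod t -> s = t.
Proof.
case: s t => [s1 s2 sP] [t1 t2 tP] /= e1 e2; subst t1 t2.
by congr Square; exact: Prop_irrelevance.
Qed.

Section SquareOps.
Variables f g h : mono.

Definition sq1 : square f f := @Square f f idfun idfun (fun=> erefl).

Lemma sqM_subproof (t : square g h) (s : square f g) x :
  (sq_cod t \o sq_cod s) (f x) = h ((sq_dom t \o sq_dom s) x).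
Proof. by rewrite /= !squareP. Qed.
Definition sqM (t : square g h) (s : square f g) : square f h :=
  Square (sqM_subproof t s).

Lemma sq0_subproof x : (0 : {linear mcod f -> mcod g}) (f x) =
  g ((0 : {linear mdom f -> mdom g}) x).
Proof. by rewrite /= raddf0. Qed.
Definition sq0 : square f g := Square sq0_subproof.

Lemma sqD_subproof (s t : square f g) x :
  (sq_cod s + sq_cod t) (f x) = g ((sq_dom s + sq_dom t) x).
Proof. by rewrite /= raddfD !squareP. Qed.
Definition sqD s t : square f g := Square (sqD_subproof s t).

Lemma sqN_subproof (s : square f g) x :
  (- sq_cod s) (f x) = g ((- sq_dom s) x).
Proof. by rewrite /= raddfN squareP. Qed.
Definition sqN s : square f g := Square (sqN_subproof s).
End SquareOps.

Program Definition mono_cat : preadditive := {|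
  obj := mono; hom := square; idm := sq1; compm := sqM;
  hom0 := sq0; homD := sqD; homN := sqN |}.
Next Obligation. by apply: square_ext; apply: linear_ext. Qed.
Next Obligation. by apply: square_ext; apply: linear_ext. Qed.
Next Obligation. by apply: square_ext; apply: linear_ext. Qed.
Next Obligation. by move=> a b c; apply: square_ext; exact: addrA. Qed.
Next Obligation. by move=> a b; apply: square_ext; exact: addrC. Qed.
Next Obligation. by move=> a; apply: square_ext; exact: add0r. Qed.
Next Obligation. by move=> a; apply: square_ext; exact: addNr. Qed.
Next Obligation. by apply: square_ext; apply: linear_ext. Qed.
Next Obligation.
by apply: square_ext; apply: linear_ext => x /=; rewrite raddfD.
Qed.

Definition upsilon_presheaf (f : mono) : presheaf := coker (yo_map f).

Lemma upsilon_fin_pres f : fin_pres (upsilon_presheaf f).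
Proof.
exists (mdom f), (mcod f), (yo_map f), (coker_proj (yo_map f)).
exact: coker_exact.
Qed.

Lemma upsilon_pd f : pd_le1 (upsilon_presheaf f).
Proof.
exists (yo (mdom f)), (yo (mcod f)), (yo_map f), (coker_proj (yo_map f)).
have [ex su] := coker_exact (yo_map f).
split=> //; try exact: yo_proj.
move=> X g h /= gh; apply: linear_ext => x; apply: (@monoP f).
by move: (congr1 (fun k : {linear _ -> _} => k x) gh).
Qed.

Definition upsilon_obj (f : mono_cat) : pd1_cat :=
  @SubObj mod_cat (fun F => pd_le1 (subval F))
    (@SubObj presheaf_cat fin_pres (upsilon_presheaf f) (upsilon_fin_pres f))
    (upsilon_pd f).

Lemma upsilon_square (f g : mono) (s : square f g) :
  natM (yo_map (sq_cod s)) (yo_map f) = natM (yo_map g) (yo_map (sq_dom s)).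
Proof.
by apply: nattrans_ext => X h; apply: linear_ext => x /=; rewrite squareP.
Qed.

Definition upsilon_map (f g : mono_cat) (s : hom f g) :
  hom (upsilon_obj f) (upsilon_obj g) := coker_map (upsilon_square s).

Lemma upsilon_mapE (f g : mono_cat) (s : hom f g) (X : objM) (h : yo (mcod f) X) :
  upsilon_map s X (coker_proj (yo_map f) X h) =
  coker_proj (yo_map g) X (yo_map (sq_cod s) X h).
Proof. exact: qmapE. Qed.

Lemma upsilon_map1 (f : mono_cat) : upsilon_map (idm f) = idm (upsilon_obj f).
Proof.
apply: nattrans_ext => X x; have [h <-] := (coker_exact (yo_map f)).2 X x.
by rewrite upsilon_mapE; congr (coker_proj _ X _); apply: linear_ext.
Qed.

Lemma upsilon_mapM (f g h : mono_cat) (t : hom g h) (s : hom f g) :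
  upsilon_map (compm t s) = compm (upsilon_map t) (upsilon_map s).
Proof.
apply: nattrans_ext => X x; have [y <-] := (coker_exact (yo_map f)).2 X x.
rewrite upsilon_mapE; apply: esym.
apply: (etrans (congr1 (upsilon_map t X) (upsilon_mapE s y))).
by rewrite upsilon_mapE; congr (coker_proj _ X _); apply: linear_ext.
Qed.

Lemma upsilon_mapD (f g : mono_cat) (s t : hom f g) :
  upsilon_map (homD s t) = homD (upsilon_map s) (upsilon_map t).
Proof.
apply: nattrans_ext => X x; have [y <-] := (coker_exact (yo_map f)).2 X x.
rewrite upsilon_mapE; apply: esym.
apply: (etrans (f_equal2 +%R (upsilon_mapE s y) (upsilon_mapE t y))).
by rewrite -raddfD; congr (coker_proj _ X _); apply: linear_ext.
Qed.

Definition Upsilon : functor mono_cat pd1_cat :=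
  @Functor mono_cat pd1_cat upsilon_obj upsilon_map
    upsilon_map1 upsilon_mapM upsilon_mapD.

Definition incl_stab : functor mod_stab_cat mod_cat :=
  @incl mod_cat (fun F => vanishes_on_proj (subval F)).
Definition incl_pd1 : functor pd1_cat mod_cat :=
  @incl mod_cat (fun F => pd_le1 (subval F)).

Section StableQuotient.
Variable n : nat.
Hypothesis ctM : cluster_tilting M n.

Lemma ct_retract (A X : fgMod R) (i : {linear A -> X}) (r : {linear X -> A}) :
  M X -> (forall a, r (i a) = a) -> M A.
Proof.
move=> MX ri; apply/(ct_right_perp ctM) => Y MY j jn P.
have := (ct_right_perp ctM X).1 MX Y MY j jn P.
case: j jn => [|j] _ ext f f0 //.
have [x|g gf] := ext (i \o f : {linear P j.+1 -> X}).
  by rewrite /= f0 raddf0.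
by exists (r \o g : {linear P j -> A}) => x; rewrite /= gf /= ri.
Qed.

Lemma ct_proj (P : fgMod R) : proj_module P -> M P.
Proof.
move=> pP; have [X [MX [f fS]]] := ct_generating ctM P.
have [s fs] := pP X P f (idfun : {linear P -> P}) fS.
exact: (ct_retract MX fs).
Qed.

Section Prod.
Variables U V : lmodType R.
Definition pin (W : lmodType R) (f : {linear W -> U}) (g : {linear W -> V}) (w : W)
  : (U * V)%type := (f w, g w).
Lemma pin_lin (W : lmodType R) (f : {linear W -> U}) (g : {linear W -> V}) :
  linear (pin f g).
Proof. by move=> a x y; rewrite /pin !linearP. Qed.
HB.instance Definition _ (W : lmodType R) (f : {linear W -> U})
  (g : {linear W -> V}) := GRing.isLinear.Build R W (U * V)%type *:%R (pin f g)
    (pin_lin f g).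
Definition prl : {linear (U * V)%type -> U} := fst.
Definition prr : {linear (U * V)%type -> V} := snd.
Definition pairl (W : lmodType R) (f : {linear W -> U}) (g : {linear W -> V}) :
  {linear W -> (U * V)%type} := pin f g.

Lemma prod_fg : fin_gen U -> fin_gen V -> fin_gen (U * V)%type.
Proof.
move=> [m [e eP]] [m' [e' eP']].
exists (m + m')%N, (fun i => match split i with
  | inl j => (e j, 0) | inr j => (0, e' j) end) => -[u v].
have [c ->] := eP u; have [c' ->] := eP' v.
exists (fun i => match split i with inl j => c j | inr j => c' j end).
rewrite big_split_ord /=.
have sl i : split (lshift m' i) = inl i := unsplitK (inl i : 'I_m + 'I_m').
have sr i : split (rshift m i) = inr i := unsplitK (inr i : 'I_m + 'I_m').
under [X in _ = X + _]eq_bigr => i _ do rewrite sl.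
under [X in _ = _ + X]eq_bigr => i _ do rewrite sr.
apply: injective_projections.
  rewrite [RHS](raddfD prl) !(raddf_sum prl) /=.
  by rewrite [X in _ + X]big1 ?addr0 // => i _; rewrite scaler0.
rewrite [RHS](raddfD prr) !(raddf_sum prr) /=.
by rewrite [X in X + _]big1 ?add0r // => i _; rewrite scaler0.
Qed.

Lemma prod_proj : proj_module U -> proj_module V -> proj_module (U * V)%type.
Proof.
move=> pU pV A B e f eS.
pose iU : {linear U -> (U * V)%type} := pairl idfun \0.
pose iV : {linear V -> (U * V)%type} := pairl \0 idfun.
have [g ge] := pU A B e (f \o iU : {linear U -> B}) eS.
have [h he] := pV A B e (f \o iV : {linear V -> B}) eS.
exists ((g \o prl) \+ (h \o prr) : {linear (U * V)%type -> A}) => -[u v].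
rewrite [LHS]raddfD [LHS](f_equal2 +%R (ge u) (he v)).
rewrite [LHS]/= -[LHS](raddfD f); congr (f _); apply: injective_projections; rewrite /= ?addr0 ?add0r //.
Qed.
End Prod.

Definition prod_fgMod (A B : fgMod R) : fgMod R := FgMod (prod_fg (fgP A) (fgP B)).

Lemma prod_M (A B : objM) : M (prod_fgMod A B).
Proof.
apply: (add_sum (ct_additive ctM) (modMP A) (modMP B)).
by exists idfun; exists id.
Qed.
Definition prodM (A B : objM) : objM := ObjM (prod_M A B).

(** [trace x]: the element x of F(X) comes from a projective module along some
    morphism out of X. Dividing F by these elements gives the largest quotient
    of F that vanishes on projective modules. *)
Definition trace (F : presheaf) (X : objM) (x : F X) : Prop :=
  exists (P : objM) (g : {linear X -> P}) (y : F P),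
    proj_module P /\ x = pmap F g y.

Lemma trace0 (F : presheaf) (X : objM) : trace (0 : F X).
Proof.
have [Z MZ Z0] := add_zero (ct_additive ctM).
exists (ObjM MZ), 0, 0; split; last by rewrite raddf0.
move=> A B e f _; exists 0 => z /=.
by rewrite raddf0 (Z0 z) raddf0.
Qed.

Lemma traceB (F : presheaf) (X : objM) (x y : F X) : trace x -> trace y -> trace (x - y).
Proof.
move=> [P [g [u [pP ->]]]] [Q [h [v [pQ ->]]]].
pose c : {linear X -> prodM P Q} := pairl g h.
pose p1 : {linear prodM P Q -> P} := prl P Q.
pose p2 : {linear prodM P Q -> Q} := prr P Q.
exists (prodM P Q), c, (pmap F p1 u - pmap F p2 v).
split; first exact: prod_proj.
rewrite raddfB -(pmapM p1) -(pmapM p2); congr (pmap F _ u - pmap F _ v);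
  exact: linear_ext.
Qed.

Definition trace_pred (F : presheaf) (X : objM) : zmodClosed (F X) :=
  zmod_pred (trace0 F X) (@traceB F X).

Lemma trace_stable (F : presheaf) (X Y : objM) (f : {linear X -> Y}) x :
  x \in trace_pred F Y -> pmap F f x \in trace_pred F X.
Proof.
move=> /zmod_predP[P [g [y [pP ->]]]]; apply/zmod_predP.
by exists P, (g \o f : {linear X -> P}), y; split=> //; rewrite pmapM.
Qed.

Definition trace_sub F : subpresheaf F := SubPresheaf (@trace_stable F).
Definition stab_quot F : presheaf := quot_presheaf (trace_sub F).

Lemma stab_quot_vanish F : vanishes_on_proj (stab_quot F).
Proof.
move=> P pP x; have [y <-] := qpi_surj x; apply/qpi_eq0/zmod_predP.
by exists P, (idfun : {linear P -> P}), y; split=> //; rewrite pmap1.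
Qed.

Section Free.
Variables (A : lmodType R) (m : nat) (e : 'I_m -> A).
Definition free_fun (c : 'rV[R]_m) : A := \sum_(i < m) c 0 i *: e i.
Lemma free_lin : linear free_fun.
Proof.
move=> a x y; rewrite /free_fun scaler_sumr -big_split /=.
by apply: eq_bigr => i _; rewrite !mxE scalerDl scalerA.
Qed.
HB.instance Definition _ :=
  GRing.isLinear.Build R 'rV[R]_m A *:%R free_fun free_lin.
End Free.

Lemma free_proj m : proj_module ('rV[R]_m : lmodType R).
Proof.
move=> A B e f eS.
have /choice[a aE] : forall i : 'I_m, exists a, e a = f (delta_mx 0 i).
  by move=> i; exact: eS.
exists (free_fun a) => c; rewrite /= /free_fun raddf_sum.
rewrite [in RHS](row_sum_delta c) raddf_sum; apply: eq_bigr => i _.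
apply: (etrans (linearZ_LR e _ _)); rewrite aE.
exact: esym (linearZ_LR f _ _).
Qed.

Lemma free_fg m : fin_gen ('rV[R]_m : lmodType R).
Proof.
exists m, (fun i => delta_mx 0 i) => v; exists (fun i => v 0 i).
exact: row_sum_delta.
Qed.

Lemma stab_quot_fin_pres F : fin_pres F -> fin_pres (stab_quot F).
Proof.
move=> [A1 [A0 [a [p [ap pS]]]]].
have [m [e eP]] := fgP A0.
pose L := ObjM (ct_proj (P := FgMod (free_fg m)) (free_proj (m := m))).
pose q : {linear L -> A0} := free_fun e.
have qS : surj q by move=> x; have [c ->] := eP x; exists (\row_i c i);
  apply: eq_bigr => i _; rewrite mxE.
pose a0 : {linear A1 -> A0} := a A1 (idfun : {linear A1 -> A1}).
have aE (X : objM) (k : {linear X -> A1}) : a X k = (a0 \o k : {linear X -> A0}).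
  have -> : k = pmap (yo A1) k (idfun : {linear A1 -> A1}) by exact: linear_ext.
  by rewrite ncompP; exact: linear_ext.
have pE (X : objM) (Y : objM) (h : {linear Y -> A0}) (k : {linear X -> Y}) :
  p X (h \o k : {linear X -> A0}) = pmap F k (p Y h) by exact: (ncompP p k h).
pose b : {linear prodM A1 L -> A0} := (a0 \o prl A1 L) \+ (q \o prr A1 L).
exists (prodM A1 L), A0, (yo_map b), (natM (quot_proj (trace_sub F)) p).
split=> X; last first.
  move=> y; have [z <-] := qpi_surj y; have [w <-] := pS X z; by exists w.
move=> y; apply: (iff_trans (qpi_eq0 _ _)); apply: (iff_trans (zmod_predP _ _ _)).
split.
  move=> [P [g [z [pP py]]]]; have [v vz] := pS P z; subst z.
  have [w wv] := pP L A0 q v qS.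
  have : p X (y - (q \o (w \o g) : {linear X -> A0})) = 0.
    rewrite raddfB py -pE; apply/eqP; rewrite subr_eq0; apply/eqP.
    by congr (p X _); apply: linear_ext => x /=; rewrite wv.
  move=> /ap[k ky]; exists (pairl k (w \o g)); apply: linear_ext => x /=.
  move: (congr1 (fun h : {linear _ -> _} => h x) ky); rewrite aE /= => ->.
  by rewrite subrK.
move=> [u <-]; exists L, (prr A1 L \o u : {linear X -> L}), (p L q).
split; first exact: free_proj.
rewrite -pE; apply/eqP; rewrite -subr_eq0 -raddfB; apply/eqP/ap.
exists (prl A1 L \o u : {linear X -> A1}); rewrite aE; apply: linear_ext => x /=.
by rewrite addrK.
Qed.

Lemma trace_map (F G : presheaf) (a : nattrans F G) X x :
  x \in trace_sub F X -> a X x \in trace_sub G X.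
Proof.
move=> /zmod_predP[P [g [y [pP ->]]]]; apply/zmod_predP.
by exists P, g, (a P y); split=> //; rewrite ncompP.
Qed.

Definition stab_obj (F : mod_cat) : mod_stab_cat :=
  @SubObj mod_cat (fun F => vanishes_on_proj (subval F))
    (@SubObj presheaf_cat fin_pres (stab_quot (subval F))
      (stab_quot_fin_pres (subvalP F)))
    (stab_quot_vanish (F := subval F)).

Definition stab_map (F G : mod_cat) (a : hom F G) :
  hom (stab_obj F) (stab_obj G) := quot_map (@trace_map _ _ a).

Lemma stab_mapE (F G : mod_cat) (a : hom F G) X x :
  stab_map a X (qpi (trace_sub (subval F) X) x) = qpi _ (ncomp a X x).
Proof. exact: qmapE. Qed.

Lemma stab_map1 F : stab_map (idm F) = idm (stab_obj F).
Proof.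
by apply: nattrans_ext => X x; have [y <-] := qpi_surj x; rewrite stab_mapE.
Qed.
Lemma stab_mapM (F G H : mod_cat) (b : hom G H) (a : hom F G) :
  stab_map (compm b a) = compm (stab_map b) (stab_map a).
Proof.
apply: nattrans_ext => X x; have [y <-] := qpi_surj x; rewrite stab_mapE.
apply: esym; apply: (etrans (congr1 (stab_map b X) (stab_mapE a y))).
exact: stab_mapE.
Qed.
Lemma stab_mapD (F G : mod_cat) (a b : hom F G) :
  stab_map (homD a b) = homD (stab_map a) (stab_map b).
Proof.
apply: nattrans_ext => X x; have [y <-] := qpi_surj x; rewrite stab_mapE.
apply: esym; apply: (etrans (f_equal2 +%R (stab_mapE a y) (stab_mapE b y))).
by rewrite -raddfD.
Qed.

Definition stab_functor : functor mod_cat mod_stab_cat :=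
  @Functor mod_cat mod_stab_cat stab_obj stab_map stab_map1 stab_mapM stab_mapD.

Lemma trace_kill (F G : presheaf) (a : nattrans F G) X x :
  vanishes_on_proj G -> x \in trace_sub F X -> a X x = 0.
Proof.
move=> G0 /zmod_predP[P [g [y [pP ->]]]].
by rewrite ncompP (G0 P pP (a P y)) raddf0.
Qed.

Section Descend.
Variables (F G : presheaf) (a : nattrans F G) (G0 : vanishes_on_proj G).

Definition desc_fun (X : objM) (y : stab_quot F X) : G X := a X (repr y).

Lemma desc_funE X x : desc_fun (qpi (trace_sub F X) x) = a X x.
Proof.
apply/eqP; rewrite -subr_eq0 -raddfB; apply/eqP/(trace_kill _ G0).
by apply/qpi_eq; rewrite /qpi reprK.
Qed.

Lemma desc_additive X : zmod_morphism (@desc_fun X).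
Proof.
move=> u v; have [x <-] := qpi_surj u; have [y <-] := qpi_surj v.
by rewrite -[qpi _ x - _]raddfB !desc_funE raddfB.
Qed.
HB.instance Definition _ X := GRing.isZmodMorphism.Build
  (stab_quot F X) (G X) (@desc_fun X) (@desc_additive X).

Lemma desc_nat (X Y : objM) (f : {linear X -> Y}) y :
  desc_fun (pmap (stab_quot F) f y) = pmap G f (desc_fun y).
Proof.
have [x <-] := qpi_surj y; rewrite desc_funE -ncompP.
by apply: etrans (desc_funE _); congr desc_fun; exact: qmapE.
Qed.

Definition desc : nattrans (stab_quot F) G :=
  @NatTrans (stab_quot F) G (fun X => @desc_fun X) desc_nat.
End Descend.

Lemma stab_functor_adjoint : left_adjoint stab_functor incl_stab.
Proof.
exists (fun F Y (a : hom (stab_functor F) Y) =>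
  natM a (quot_proj (trace_sub (subval F)))).
split=> [F G|F' F G G' f g h].
  exists (fun a => @desc (subval F) _ a (subvalP G)) => a.
    apply: nattrans_ext => X x; have [y <-] := qpi_surj x.
    exact: (desc_funE _ (subvalP G) y).
  by apply: nattrans_ext => X x; exact: (desc_funE _ (subvalP G) x).
apply: nattrans_ext => X x.
exact: (congr1 (fun z => ncomp g X (ncomp h X z)) (stab_mapE f x)).
Qed.

End StableQuotient.

Theorem incl_stab_has_left_adjoint n :
  cluster_tilting M n -> exists il, left_adjoint il incl_stab.
Proof. by move=> ctM; exists (stab_functor ctM); exact: stab_functor_adjoint. Qed.

(** [il] is to be a left adjoint of [incl_stab]; composing with [incl_pd1]
    restricts it to the functors of projective dimension at most one. *)
Definition Phi (il : functor mod_cat mod_stab_cat) :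
  functor mono_cat mod_stab_cat :=
  comp_functor (comp_functor il incl_pd1) Upsilon.

End FunctorsOnM.

(* Main.v *)
(** Composing [M(-, M2) -> Upsilon f] with the unit of the adjunction gives an
    epimorphism [M(-, M2) -> Phi f] whose kernel consists of the maps [f a + q g]
    where [g] goes to a projective module. Everything then rests on two
    properties of a self-injective artin algebra: finitely generated projectives
    are injective, and every finitely generated module embeds in one of them.
    - Full: a natural map [Phi f -> Phi f'] lifts to [t : M2 -> M2'] with
      [t f = f' a + q g]; extending [g] along [f] to [g'], the map [t - q g']
      completes [a] to a square inducing the given map.
    - Dense: if [M1 -> M0] presents a functor vanishing on projectives, add to it
      an embedding of [M1] in a projective [I]; the mono [M1 -> M0 + I] is sent
      to the given functor.
    - Objective: if [Phi s = 0], then [s_2 = f' a + q g], where [g : M2 -> Q] can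
      be taken injective, and [s] factors through the mono
      [id + g f : M2 + M1 -> M2 + Q].

    The embedding property requires every simple left module to embed in the
    algebra. For a maximal left ideal [N] let [core N] be the annihilator of the
    simple module [L/N]. The left annihilator of [core N] is nonzero, so it
    contains a minimal left ideal [L s], and [N' = ann s] is again a maximal left
    ideal. The double annihilator property of right ideals shows that [core N]
    is determined by [core N']. If [L/N0] did not embed in [L], iterating
    [N |-> N'] from [N0] would thus give pairwise distinct, hence comaximal, cores,
    whose successive intersections contradict the descending chain condition. *)
Require Import Defs.
From HB Require Import structures.
From mathcomp Require Import all_boot all_algebra.
From mathcomp Require Import boolp.

Set Implicit Arguments.
Unset Strict Implicit.
Unset Printing Implicit Defensive.

Import GRing.Theory.
Local Open Scope ring_scope.

(** * Descending chains *)

Section Chains.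
Variable R : nzRingType.

Definition submod (A : lmodType R) (X : A -> Prop) : Prop :=
  [/\ X 0, forall x y, X x -> X y -> X (x + y) & forall a x, X x -> X (a *: x)].

Definition dcc (A : lmodType R) : Prop :=
  forall C : nat -> A -> Prop, (forall i, submod (C i)) ->
    (forall i x, C i.+1 x -> C i x) ->
    exists N, forall i x, (N <= i)%N -> C N x -> C i x.

Lemma chain_le (T : Type) (C : nat -> T -> Prop) :
  (forall i x, C i.+1 x -> C i x) -> forall i j x, (i <= j)%N -> C j x -> C i x.
Proof.
move=> dC i j x /subnK <-; elim: (j - i)%N => // d IH.
by rewrite addSn => /dC.
Qed.

Lemma submodB (A : lmodType R) (X : A -> Prop) x y :
  submod X -> X x -> X y -> X (x - y).
Proof. by case=> _ XD XZ Xx Xy; apply: XD => //; rewrite -scaleN1r; exact: XZ. Qed.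

Fixpoint span_seq (A : lmodType R) (s : seq A) (x : A) : Prop :=
  if s is e :: s' then exists r, span_seq s' (x - r *: e) else x = 0.

Lemma submod_span (A : lmodType R) (s : seq A) : submod (span_seq s).
Proof.
elim: s => [|e s [IH0 IHD IHZ]] /=.
  by split=> // [x y -> ->|a x ->]; rewrite ?addr0 ?scaler0.
split=> [|x y [r xr] [t yt]|a x [r xr]].
- by exists 0; rewrite scale0r subr0.
- by exists (r + t); rewrite scalerDl opprD addrACA; exact: IHD.
- by exists (a * r); rewrite -scalerA -scalerBr; exact: IHZ.
Qed.

Lemma span_seq_sum (A : lmodType R) (m : nat) (e : 'I_m -> A) (c : 'I_m -> R) s :
  span_seq (map e s) (\sum_(i <- s) c i *: e i).
Proof.
elim: s => [|i s IH] /=; first by rewrite big_nil.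
by exists (c i); rewrite big_cons addrC addKr.
Qed.

(** Induction on [s]: the coefficients of [e] in members of [C i] form a chain of left ideals, the
    members lying in the span of the rest form a second chain, and once both are stationary so is
    [C]. *)
Lemma dcc_span (A : lmodType R) (s : seq A) : dcc R^o ->
  forall C : nat -> A -> Prop, (forall i, submod (C i)) ->
    (forall i x, C i.+1 x -> C i x) -> (forall i x, C i x -> span_seq s x) ->
    exists N, forall i x, (N <= i)%N -> C N x -> C i x.
Proof.
move=> dR; elim: s => [|e s IH] C Csub Cdec Cs.
  by exists 0%N => i x _ /Cs /= ->; case: (Csub i).
have [s0 sD sZ] := submod_span s.
pose D i (r : R^o) := exists2 w, span_seq s w & C i (r *: e + w).
have [N1 N1P] : exists N, forall i x, (N <= i)%N -> D N x -> D i x.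
  apply: dR => [i|i r [w sw /Cdec Cw]]; last by exists w.
  have [C0 CD CZ] := Csub i; split=> [|x y [w sw Cw] [v sv Cv]|a x [w sw Cw]].
  - by exists 0; rewrite ?scale0r ?addr0.
  - by exists (w + v); [exact: sD|rewrite scalerDl addrACA; exact: CD].
  - exists (a *: w); first exact: sZ.
    by rewrite -[a *: x]/(a * x) -scalerA -scalerDr; exact: CZ.
have [N2 N2P] : exists N, forall i x, (N <= i)%N ->
    C N x /\ span_seq s x -> C i x /\ span_seq s x.
  apply: (IH (fun i x => C i x /\ span_seq s x)) => [i|i x [/Cdec]|i x []] //.
  have [C0 CD CZ] := Csub i.
  by split=> [//|x y [Cx sx] [Cy sy]|a x [Cx sx]]; split;
    [exact: CD|exact: sD|exact: CZ|exact: sZ].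
exists (maxn N1 N2) => i x; rewrite geq_max => /andP[N1i N2i] Cx.
have [r sx] := Cs _ _ Cx.
have [w sw Cw] : D i r.
  apply: (N1P) => //; exists (x - r *: e) => //.
  by rewrite addrC subrK; apply: (chain_le Cdec (leq_maxl _ N2)).
have [] : C i (x - (r *: e + w)) /\ span_seq s (x - (r *: e + w)).
  apply: N2P => //; split.
    apply: submodB => //; first exact: (chain_le Cdec (leq_maxr N1 _)).
    exact: (chain_le Cdec N2i).
  by rewrite opprD addrA; apply: submodB => //; exact: submod_span.
move=> Cxw _; rewrite -(subrK (r *: e + w) x).
by case: (Csub i) => _ + _; exact.
Qed.

Lemma dcc_fin_gen (A : lmodType R) : dcc R^o -> fin_gen A -> dcc A.
Proof.
move=> dR [m [e eP]] C Csub Cdec.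
apply: (dcc_span (s := map e (index_enum 'I_m)) dR) => // i x _.
by have [c ->] := eP x; exact: span_seq_sum.
Qed.

(** Without a minimal member, choice yields a strictly descending sequence in [F]. *)
Lemma dcc_min (A : lmodType R) (F : (A -> Prop) -> Prop) : dcc A ->
  (forall X, F X -> submod X) -> (exists X, F X) ->
  exists2 X, F X & forall Y, F Y -> (forall y, Y y -> X y) -> forall x, X x -> Y x.
Proof.
move=> dA Fsub [X0 FX0]; apply: contrapT => nomin.
have next (X : {X | F X}) : exists Y : {X | F X},
    (forall y, sval Y y -> sval X y) /\ exists2 x, sval X x & ~ sval Y x.
  case: X => X FX /=; apply: contrapT => noY; apply: nomin; exists X => // Y FY YX x Xx.
  apply: contrapT => nYx; apply: noY; exists (exist _ Y FY); split=> //=.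
  by exists x.
have /choice[step stepP] := next.
pose C i := iter i step (exist _ X0 FX0).
have [i|i x|N NP] := dA (fun i => sval (C i)).
- exact: Fsub (svalP _).
- exact: (stepP (C i)).1.
have [x Cx nCx] := (stepP (C N)).2.
exact: nCx (NP N.+1 x (leqnSn N) Cx).
Qed.

End Chains.

(** Left ideals are [k]-submodules of [L], which is finitely generated over the artinian ring
    [k]. *)
Lemma dcc_artin_algebra (k : comNzRingType) (L : algType k) :
  artin_algebra L -> dcc (L^o : lmodType L).
Proof.
move=> [ak fg] C Csub Cdec.
have dk : dcc (k^o : lmodType k) by move=> D Dsub; exact: ak.
apply: (dcc_fin_gen dk fg) => // i.
have [C0 CD CZ] := Csub i; split=> // a x Cx.
by rewrite -mulr_algl; exact: CZ.
Qed.

(** * Extension of partially defined linear maps *)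

Section Extension.
Variable R : nzRingType.

Section Graph.
Variables (B I : lmodType R) (G : B -> I -> Prop).
Hypothesis GD : forall a b b' y y', G b y -> G b' y' -> G (a *: b + b') (a *: y + y').
Hypothesis G0 : G 0 0.

Definition graph_pred : {pred (B * I)%type} := fun p => `[< G p.1 p.2 >].

Lemma graph_closed : submod_closed graph_pred.
Proof.
split=> [|a [b y] [b' y'] /asboolP /= Gb /asboolP /= Gb']; apply/asboolP => //=.
exact: GD.
Qed.
HB.instance Definition _ := GRing.isSubmodClosed.Build R (B * I)%type graph_pred graph_closed.

Record graph := Graph { graph_val :> (B * I)%type; graphP : graph_val \in graph_pred }.
HB.instance Definition _ := [isSub for graph_val].
HB.instance Definition _ := [Choice of graph by <:].
HB.instance Definition _ := [SubChoice_isSubLmodule of graph by <:].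

(** The graph is a submodule of [B * I] on which the first projection is injective, so the second
    projection extends along it to [B]. *)
Lemma inj_extend : inj_module I -> (forall y, G 0 y -> y = 0) ->
  exists g : {linear B -> I}, forall b y, G b y -> g b = y.
Proof.
move=> injI Gfun.
pose m : {linear graph -> B} := fst \o (val : graph -> (B * I)%type).
pose f : {linear graph -> I} := snd \o (val : graph -> (B * I)%type).
have [|g gP] := injI graph B m f.
  move=> u v uv; apply/eqP; rewrite -subr_eq0; apply/eqP/val_inj.
  have muv : m (u - v) = 0.
    by apply/eqP; rewrite (raddfB m) subr_eq0; exact/eqP.
  have : G (m (u - v)) (f (u - v)) by exact/asboolP/(graphP (u - v)).
  by rewrite muv => /Gfun fuv; exact: injective_projections.
exists g => b y Gby.
have Gin : (b, y) \in graph_pred by exact/asboolP.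
exact: (gP (Graph Gin)).
Qed.
End Graph.
End Extension.

(** * Maximal left ideals of left self-injective left artinian rings *)

Section Kasch.
Variable R : nzRingType.
Hypothesis dR : dcc (R^o : lmodType R).
Implicit Types (N : R -> Prop).

Definition lideal N := submod (N : (R^o : lmodType R) -> Prop).
(** Maximality in computational form: [R/N] is nonzero and generated by each of its nonzero
    classes. *)
Definition maxl N := [/\ lideal N, ~ N 1 & forall x, ~ N x -> exists y, N (1 - y * x)].
(* The annihilator of the left module [R/N]. *)
Definition core N (x : R) := forall b, N (x * b).
Definition lann (x : R) : R -> Prop := fun z => z * x = 0.

Lemma lidealM N a x : lideal N -> N x -> N (a * x).
Proof. by case=> _ _; exact. Qed.

Lemma lidealB N x y : lideal N -> N x -> N y -> N (x - y).
Proof. exact: submodB. Qed.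

Lemma lidealD N x y : lideal N -> N x -> N y -> N (x + y).
Proof. by case=> _ + _; exact. Qed.

Lemma lidealBr N x y : lideal N -> N (x - y) -> N y -> N x.
Proof. by move=> lN Nxy Ny; rewrite -(subrK y x); exact: lidealD. Qed.

Lemma lidealBl N x y : lideal N -> N (x - y) -> N x -> N y.
Proof. by move=> lN Nxy Nx; rewrite -(subKr x y); exact: lidealB. Qed.

Lemma lideal_core N : lideal N -> lideal (core N).
Proof.
move=> lN; split=> [b|x y Px Py b|a x Px b].
- by rewrite mul0r; case: lN.
- by rewrite mulrDl; exact: lidealD.
- by rewrite /= -[a *: x]/(a * x) -mulrA; exact: lidealM.
Qed.

Lemma coreM N x b : core N x -> core N (x * b).
Proof. by move=> Px c; rewrite -mulrA. Qed.

Lemma core_sub N x : core N x -> N x.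
Proof. by move=> /(_ 1); rewrite mulr1. Qed.

Lemma lideal_ann (A : lmodType R) (a : A) : lideal (fun r => r *: a = 0).
Proof.
split=> [|x y xa ya|x y ya]; rewrite ?scale0r // ?scalerDl ?xa ?ya ?addr0 //.
by rewrite -[x *: y]/(x * y) -scalerA ya scaler0.
Qed.

(** A minimal left ideal strictly above [N] is generated modulo [N] by any of its elements outside
    [N], so [u] spans a simple submodule of [R/N]. *)
Lemma simple_elt N : lideal N -> ~ N 1 ->
  exists2 u, ~ N u & forall x, ~ N (x * u) -> exists y, N (u - y * (x * u)).
Proof.
move=> lN N1.
pose F (X : R^o -> Prop) :=
  [/\ submod X, forall x, N x -> X x & exists2 x, X x & ~ N x].
have [X [sX NX [u Xu Nu]] Xmin] : exists2 X, F X & forall Y, F Y ->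
    (forall y, Y y -> X y) -> forall x, X x -> Y x.
  apply: dcc_min => // [X []//|]; exists (fun=> True); split=> //.
  by exists 1.
exists u => // x Nxu.
pose Y (z : R) := exists y, N (z - y * (x * u)).
have /Xmin Ymin : F Y.
  split=> [|z Nz|]; last 2 first.
  - by exists 0; rewrite mul0r subr0.
  - by exists (x * u) => //; exists 1; rewrite mul1r subrr; case: lN.
  split=> [|z z' [y Yz] [y' Yz']|a z [y Yz]].
  - by exists 0; rewrite mul0r subr0; case: lN.
  - by exists (y + y'); rewrite mulrDl opprD addrACA; exact: lidealD.
  - by exists (a * y); rewrite -[a *: z]/(a * z) -mulrA -mulrBr; exact: lidealM.
apply: Ymin => // z [y /NX Xzy].
apply: (lidealBr sX Xzy); rewrite mulrA.
exact: (lidealM _ sX).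
Qed.

(** The module [R a] is [R] modulo the annihilator of [a], and [simple_elt] finds a simple submodule
    in it. *)
Lemma simple_ann (A : lmodType R) (a : A) : a <> 0 ->
  exists u, u *: a <> 0 /\ maxl (fun r => r *: (u *: a) = 0).
Proof.
move=> a0; have [|u ua uP] := simple_elt (lideal_ann a); first by rewrite scale1r.
exists u; split=> //; split=> [||x]; first exact: lideal_ann.
  by rewrite scale1r.
rewrite scalerA => /uP[y yP]; exists y.
by rewrite scalerA mulrBl mul1r -mulrA.
Qed.

(* Among the left ideals [core N + R (1 - q)] with [q] in [Q], a minimal one is
   [core N] itself, since any [t] outside [N] is fixed modulo [N] by some element
   of [Q]. *)
Lemma core_max N (Q : R -> Prop) q : maxl N -> lideal Q ->
  (forall x b, Q x -> Q (x * b)) -> (forall x, core N x -> Q x) ->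
  Q q -> ~ core N q -> Q 1.
Proof.
move=> mN lQ rQ PQ Qq Pq; have [lN N1 Nmax] := mN.
have circ (x z : R) : 1 - (x + z - x * z) = (1 - x) * (1 - z).
  by rewrite mulrBl mul1r mulrBr mulr1 !opprD !opprK !addrA (addrAC 1 (- z)).
have lP := lideal_core lN.
have [b Nqb] : exists b, ~ N (q * b) by exact/existsNP.
have [y yP] := Nmax _ Nqb.
pose F (X : R^o -> Prop) :=
  exists2 q', Q q' & X = fun z => exists x, core N (z - x * (1 - q')).
have [_ [r Qr ->] rmin] : exists2 X, F X & forall Y, F Y ->
    (forall y, Y y -> X y) -> forall x, X x -> Y x.
  apply: dcc_min => //; last by exists (fun z => exists x, core N (z - x * (1 - q))), q.
  move=> _ [r Qr ->]; split=> [|z z' [x Pz] [x' Pz']|a z [x Pz]].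
  - by exists 0; rewrite mul0r subr0; case: lP.
  - by exists (x + x'); rewrite mulrDl opprD addrACA; exact: (lidealD lP).
  - by exists (a * x); rewrite -[a *: z]/(a * z) -mulrA -mulrBr; exact: (lidealM _ lP).
suff : core N (1 - r) by move/PQ => Qr1; rewrite -(subrK r 1); exact: (lidealD lQ).
move=> a; apply: contrapT => Nt; set t := (1 - r) * a in Nt.
have [c cP] := Nmax _ Nt.
(* Both [y * (q * b)] and [c * t] are 1 modulo [N], so [r' * t] is [t] modulo [N]; the factor [q]
   puts [r'] in [Q]. *)
pose r' := t * (y * (q * b)) * c.
have Qr' : Q r' by apply: (rQ); rewrite !mulrA; apply: (rQ); exact: (lidealM _ lQ Qq).
have Nr't : N ((1 - r') * t).
  rewrite mulrBl mul1r.
  have -> : t - r' * t = t * (1 - y * (q * b)) + t * (y * (q * b)) * (1 - c * t).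
    by rewrite !mulrBr !mulr1 addrA subrK /r' !mulrA.
  by apply: (lidealD lN); exact: (lidealM _ lN).
(* By minimality [1 - r] is [x * (1 - r') * (1 - r)] modulo [core N]; multiplying by [a] puts [t] in
   [N]. *)
have [|||x] := rmin (fun z => exists x, core N (z - x * ((1 - r') * (1 - r)))) _ _ (1 - r).
- exists (r' + r - r' * r); first 
    by apply: (lidealB lQ); [exact: (lidealD lQ)|exact: (lidealM _ lQ)].
  by rewrite circ.
- by move=> z [x Px]; exists (x * (1 - r')); rewrite -mulrA.
- by exists 1; rewrite mul1r subrr; case: lP.
move=> /(_ a); rewrite mulrBl => Nd; apply: Nt; apply: (lidealBr lN Nd).
by rewrite -!mulrA; exact: (lidealM _ lN).
Qed.

(** * Double annihilators and the comparison of cores *)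

Hypothesis iR : self_injective R.

(* The left annihilator of [K] is that of a finite subset [s] of [K], so
   [z s |-> z y] is well defined and extends to a linear form. *)
Lemma right_double_ann (K : R -> Prop) (y : R) :
  K 0 -> (forall x z, K x -> K z -> K (x + z)) -> (forall x b, K x -> K (x * b)) ->
  (forall z, (forall x, K x -> z * x = 0) -> z * y = 0) -> K y.
Proof.
move=> K0 KD KM yK.
pose Fs (s : seq R) z := forall x, x \in s -> z * x = 0.
pose F (X : R^o -> Prop) := exists2 s : seq R, (forall x, x \in s -> K x) & X = Fs s.
have [_ [s sK ->] smin] : exists2 X, F X & forall Y, F Y ->
    (forall z, Y z -> X z) -> forall x, X x -> Y x.
  apply: dcc_min => //; last by exists (Fs [::]), [::].
  move=> _ [s _ ->]; split=> [x _|a b Fa Fb x xs|a b Fb x xs].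
  - by rewrite mul0r.
  - by rewrite mulrDl Fa // Fb // addr0.
  - by rewrite -[a *: b]/(a * b) -mulrA Fb // mulr0.
have sy z : Fs s z -> z * y = 0.
  move=> sz; apply: yK => x Kx.
  apply: (smin (Fs (x :: s))) => //; last by rewrite mem_head.
    exists (x :: s) => // w; rewrite inE => /orP[/eqP ->|/sK] //.
  by move=> w ws v vs; apply: ws; rewrite inE vs orbT.
pose v : 'rV[R]_(size s) := \row_i s`_i.
pose G (w : 'rV[R]_(size s)) (c : R^o) := exists2 z, w = z *: v & c = z * y.
have [|| _ [z vz ->]|g gP] := @inj_extend R 'rV[R]_(size s) R^o G _ _ iR.
- move=> a _ _ _ _ [z -> ->] [z' -> ->]; exists (a * z + z').
    by rewrite scalerDl scalerA.
  by rewrite mulrDl -mulrA.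
- by exists 0; rewrite ?scale0r ?mul0r.
- apply: sy => x xs; pose i := Ordinal (etrans (index_mem x s) xs).
  move: (congr1 (fun w : 'rV_(size s) => w 0 i) vz).
  by rewrite !mxE /= nth_index.
have -> : y = g v by rewrite (gP v y) //; exists 1; rewrite ?scale1r ?mul1r.
rewrite (row_sum_delta v) raddf_sum; apply: (big_ind K) => // i _.
by rewrite [X in K X](linearZ_LR g) mxE; apply/KM/sK/mem_nth.
Qed.

(** If only 0 killed [core N] from the left, [right_double_ann] would put 1 in [core N]. *)
Lemma maxl_next N : maxl N ->
  exists s, [/\ s <> 0, maxl (lann s) & forall p, core N p -> s * p = 0].
Proof.
move=> [lN N1 _].
have [z [z0 zP]] : exists z, z <> 0 /\ forall p, core N p -> z * p = 0.
  apply: contrapT => nz; apply: N1; apply: core_sub.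
  apply: right_double_ann => [|x y||z zP].
  - by case: (lideal_core lN).
  - by case: (lideal_core lN) => _ + _; exact.
  - exact: coreM.
  - by rewrite mulr1; apply: contrapT => z0; apply: nz; exists z.
have [u [uz mu]] := simple_ann (A := R^o) z0.
by exists (u * z); split=> // p Pp; rewrite -mulrA zP // mulr0.
Qed.

(** If the cores differ, one has an element outside the other; their sum is then a two-sided ideal
    strictly above a core, and [core_max] puts 1 in it. *)
Lemma core_eq N N' : maxl N -> maxl N' ->
  (forall q q', core N q -> core N' q' -> q + q' <> 1) -> core N = core N'.
Proof.
wlog : N N' / exists2 q, core N q & ~ core N' q.
  move=> H mN mN' PP; apply: contrapT => NN.
  have [[q]|NN'] := pselect (exists2 q, core N q & ~ core N' q).
    by move=> Pq P'q; apply: NN; apply: H => //; exists q.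
  have [[q]|N'N] := pselect (exists2 q, core N' q & ~ core N q).
    move=> P'q Pq; apply: NN; apply/esym; apply: H => //; first by exists q.
    by move=> x y Px Py; rewrite addrC; exact: PP.
  apply: NN; apply: funext => x; apply: propext; split=> [Px|Px]; apply: contrapT => nP.
    by apply: NN'; exists x.
  by apply: N'N; exists x.
move=> [q Pq P'q] mN mN' PP.
have lP : lideal (core N) by apply: lideal_core; case: mN.
have lP' : lideal (core N') by apply: lideal_core; case: mN'.
pose Q x := exists p p', [/\ core N p, core N' p' & x = p + p'].
have [|||||p [p' [Pp Pp' pp]]] := @core_max N' Q q mN'.
- split=> [|_ _ [p [p' [Pp Pp' ->]]] [r [r' [Pr Pr' ->]]]|a _ [p [p' [Pp Pp' ->]]]].
  + by exists 0, 0; split; [case: lP|case: lP'|rewrite addr0].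
  + exists (p + r), (p' + r'); rewrite addrACA.
    by split=> //; [exact: (lidealD lP)|exact: (lidealD lP')].
  + exists (a * p), (a * p'); rewrite scalerDr.
    by split=> //; [exact: (lidealM _ lP)|exact: (lidealM _ lP')].
- move=> _ b [p [p' [Pp Pp' ->]]]; exists (p * b), (p' * b).
  by split; [exact: coreM|exact: coreM|rewrite mulrDl].
- by move=> x Px; exists 0, x; split=> //; [case: lP|rewrite add0r].
- by exists q, 0; split=> //; [case: lP'|rewrite addr0].
- by [].
by case: (PP p p').
Qed.

(** If 1 = [q + q'] with [q], [q'] in the two cores, then [s = s * q']. The left annihilator [K] of
    [core N'] contains all [b * s'], so what kills [K] from the left lies in [core (lann s')], hence
    kills [s]. The double annihilator property puts [s] in [K], so [s = 0]. *)
Lemma next_core_inj N N' s s' : maxl N -> maxl N' -> s <> 0 ->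
  (forall p, core N p -> s * p = 0) -> (forall p, core N' p -> s' * p = 0) ->
  core (lann s) = core (lann s') -> core N = core N'.
Proof.
move=> mN mN' s0 sN sN' ss'; apply: core_eq => // q q' Pq Pq' qq'; apply: s0.
rewrite -[s]mulr1 -qq' mulrDr sN // add0r.
have lP' : lideal (core N') by apply: lideal_core; case: mN'.
pose K z := forall p, core N' p -> z * p = 0.
suff : K s by apply.
apply: right_double_ann => [p _|x z Kx Kz p Pp|x b Kx p Pp|z zK].
- by rewrite mul0r.
- by rewrite mulrDl Kx // Kz // addr0.
- by rewrite -mulrA Kx //; apply: (lidealM _ lP').
have : core (lann s) z.
  rewrite ss' => b; rewrite /lann -mulrA; apply: zK => p Pp.
  by rewrite -mulrA sN' // mulr0.
exact: core_sub.
Qed.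

(** A minimal left ideal above [core N] yields [c * u] spanning a copy of [R/N] in [R / core N].
    Some [c * u * b * x] is nonzero: otherwise the two-sided ideal of all [z] with [z R x = 0] would
    be strictly above [core N], hence contain 1. *)
Lemma core_kasch N x : maxl N -> x <> 0 -> (forall p, core N p -> p * x = 0) ->
  exists2 y, y <> 0 & forall m, N m -> m * y = 0.
Proof.
move=> mN x0 Px; have [lN N1 Nmax] := mN; have lP := lideal_core lN.
have [|u Pu umin] := simple_elt lP; first by move=> /core_sub.
have [a Nua] : exists a, ~ N (u * a) by exact/existsNP.
have [c Ncua] := Nmax _ Nua.
have PNcu m : N m -> core N (m * (c * u)).
  move=> Nm; apply: contrapT => Pmu; apply: Nua; rewrite mulrA in Pmu.
  have [y /(_ a)] := umin _ Pmu; rewrite mulrBl => Nd; apply: (lidealBr lN Nd).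
  rewrite -!mulrA; apply: (lidealM _ lN); apply: lidealBl Nm => //.
  by rewrite -{1}[m]mulr1 -mulrBr; exact: lidealM.
have [b cub] : exists b, c * u * b * x <> 0.
  apply: contrapT => cux; apply: x0.
  pose Q z := forall b, z * b * x = 0.
  suff /(_ 1) : Q 1 by rewrite !mul1r.
  apply: (@core_max N Q (c * u)) => //.
  - split=> [b|y z Qy Qz b|y z Qz b]; first by rewrite !mul0r.
      by rewrite !mulrDl Qy Qz addr0.
    by rewrite -[y *: z]/(y * z) -!mulrA (mulrA z) Qz mulr0.
  - by move=> y z Qy b; rewrite -(mulrA y).
  - by move=> p Pp b; apply: Px; exact: (coreM b Pp).
  - by move=> b; apply: contrapT => cub; apply: cux; exists b.
  - by move=> /(_ a); rewrite -mulrA => /(lidealD lN Ncua); rewrite subrK.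
exists (c * u * b * x) => // m /PNcu Pm.
by rewrite !mulrA -(mulrA m); apply: Px; exact: (coreM b Pm).
Qed.

Lemma kasch N : maxl N -> exists2 y, y <> 0 & forall m, N m -> m * y = 0.
Proof.
move=> mN; apply: contrapT => nK.
have next (X : {X | maxl X}) : exists s : R, [/\ s <> 0, maxl (lann s)
    & forall p, core (sval X) p -> s * p = 0] by exact: maxl_next (svalP X).
have /choice[s sP] := next.
have ms X : maxl (lann (s X)) by case: (sP X).
pose C i := iter i (fun X => exist _ (lann (s X)) (ms X)) (exist _ N mN).
pose P i := core (sval (C i)).
have mC i : maxl (sval (C i)) := svalP (C i).
(* If the first core recurred, it would kill the nonzero element [s (C i)], and [core_kasch] would
   apply. *)
have P0 i : P 0%N <> P i.+1.
  rewrite /P /= => NP; apply: nK.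
  have [s0 _ _] := sP (C i).
  by apply: (core_kasch mN s0); rewrite NP => p /core_sub.
(* A coincidence of two cores is pulled back step by step until it involves [P 0]. *)
have Pinj i j : (i < j)%N -> P i <> P j.
  elim: i j => [|i IH] [|j] //; rewrite ltnS => ij Pij.
  apply: (IH _ ij); have [si0 _ si] := sP (C i); have [_ _ sj] := sP (C j).
  exact: (next_core_inj (mC i) (mC j) si0 si sj Pij).
have lP i : lideal (P i) by apply: lideal_core; case: (mC i).
pose D i x := forall j, (j <= i)%N -> P j x.
have [i|i x Dx j ji|n nP] := dR (C := D).
- split=> [j _|x y Dx Dy j ji|a x Dx j ji]; first by case: (lP j).
    by apply: (lidealD (lP j)); [exact: Dx|exact: Dy].
  by apply: (lidealM _ (lP j)); exact: Dx.
- exact/Dx/leqW.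
have [q Dq q1] : exists2 q, D n q & P n.+1 (1 - q).
  suff : forall i, (i <= n)%N -> exists2 q, D i q & P n.+1 (1 - q) by exact.
  have comax i : (i <= n)%N -> exists2 q, P i q & P n.+1 (1 - q).
    move=> ni; apply: contrapT => nq; apply: (Pinj i n.+1) => //.
    apply: core_eq => // q q' Pq Pq' qq; apply: nq; exists q => //.
    by rewrite -qq addrC addKr.
  elim=> [_|i IH ni].
    by have [q Pq P1] := comax 0%N isT; exists q => // j; rewrite leqn0 => /eqP ->.
  have [q Dq q1] := IH (ltnW ni); have [r Pr r1] := comax _ ni.
  (* The product stays in the earlier cores because these are two-sided. *)
  exists (q * r) => [j|].
    rewrite leq_eqVlt => /orP[/eqP ->|ji]; first exact: (lidealM _ (lP _)).
    exact: (coreM r (Dq j ji)).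
  have -> : 1 - q * r = (1 - q) * r + (1 - r) by rewrite mulrBl mul1r [RHS]addrC addrA subrK.
  by apply: (lidealD (lP _)) => //; exact: coreM.
have P1 : P n.+1 1.
  by rewrite -(subrK q 1); apply: (lidealD (lP _)) => //; exact: (nP n.+1 q (leqnSn n) Dq).
by case: (mC n.+1) => _ + _; apply; exact: core_sub P1.
Qed.

(** * Embeddings in free modules; injectivity of projectives *)

(** A simple submodule of [R a] is mapped to its copy [R y] in [R], and self-injectivity extends the
    map to [A]. *)
Lemma cogenerator (A : lmodType R) (a : A) : a <> 0 ->
  exists f : {linear A -> R^o}, f a <> 0.
Proof.
move=> /simple_ann[u [_ mu]]; have [y y0 uy] := kasch mu.
pose G (b : A) (c : R^o) := exists2 z, b = z *: (u *: a) & c = z * y.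
have [|| _ [z bz ->]|g gP] := @inj_extend R A R^o G _ _ iR.
- move=> d _ _ _ _ [z -> ->] [z' -> ->]; exists (d * z + z').
    by rewrite scalerDl scalerA.
  by rewrite mulrDl -mulrA.
- by exists 0; rewrite ?scale0r ?mul0r.
- exact: uy.
exists g => ga; apply: y0; rewrite -(gP (u *: a) y).
  by rewrite (linearZ_LR g) ga scaler0.
by exists 1; rewrite ?scale1r ?mul1r.
Qed.

Section Rows.
Variables (A : lmodType R) (m : nat) (f : 'I_m -> {linear A -> R^o}).
Definition rows (a : A) : 'rV[R]_m := \row_i f i a.
Lemma rows_linear : linear rows.
Proof. by move=> c x y; apply/rowP => i; rewrite !mxE linearP. Qed.
HB.instance Definition _ := GRing.isLinear.Build R A 'rV[R]_m *:%R rows rows_linear.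
Definition rows_map : {linear A -> 'rV[R]_m} := rows.
Lemma rows_mapE a i : rows_map a 0 i = f i a.
Proof. by rewrite mxE. Qed.
End Rows.

(** Among common kernels of finitely many linear forms a minimal one is zero, since [cogenerator]
    would shrink it further. *)
Lemma embed_free (A : lmodType R) : fin_gen A ->
  exists (m : nat) (f : {linear A -> 'rV[R]_m}), injective f.
Proof.
move=> /(dcc_fin_gen dR) dA.
pose ker (s : seq {linear A -> R^o}) a := forall f, f \in s -> f a = 0.
have [_ [s ->] smin] : exists2 X, (exists s, X = ker s) & forall Y, (exists s, Y = ker s) ->
    (forall z, Y z -> X z) -> forall x, X x -> Y x.
  apply: dcc_min => //; last by exists (ker [::]), [::].
  move=> _ [s ->]; split=> [f _|a b Fa Fb f fs|a b Fb f fs].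
  - exact: raddf0.
  - by rewrite (raddfD f) [X in X + _](Fa f fs) [X in _ + X](Fb f fs) addr0.
  - by rewrite (linearZ_LR f) (Fb f fs) scaler0.
have ker0 a : ker s a -> a = 0.
  move=> sa; apply: contrapT => /cogenerator[f]; apply.
  apply: (smin (ker (f :: s))) sa _ (mem_head _ _); first by exists (f :: s).
  by move=> b fb g gs; apply: fb; rewrite inE gs orbT.
exists (size s), (rows_map (fun i : 'I_(size s) => s`_i)) => a b ab.
apply/eqP; rewrite -subr_eq0; apply/eqP/ker0 => f fs; rewrite raddfB.
pose i := Ordinal (etrans (index_mem f s) fs).
move: (congr1 (fun w : 'rV_(size s) => w 0 i) ab); rewrite !rows_mapE /= nth_index // => ->.
exact: subrr.
Qed.

Section Coordinate.
Variables (m : nat) (i : 'I_m).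
Definition row_coord (v : 'rV[R]_m) : R^o := v 0 i.
Lemma row_coord_linear : linear row_coord.
Proof. by move=> c x y; rewrite /row_coord !mxE. Qed.
HB.instance Definition _ :=
  GRing.isLinear.Build R 'rV[R]_m R^o *:%R row_coord row_coord_linear.
End Coordinate.

Lemma inj_free m : inj_module ('rV[R]_m : lmodType R).
Proof.
move=> A B e f einj.
have /choice[g gP] : forall i : 'I_m, exists g : {linear B -> R^o},
    forall x, g (e x) = row_coord i (f x).
    move=> i; have [g gP] := @iR A B e (row_coord i \o f : {linear A -> R^o}) einj.
  by exists g.
exists (rows_map g) => x; apply/rowP => i; rewrite rows_mapE; exact: gP.
Qed.

Lemma inj_proj (P : lmodType R) : fin_gen P -> proj_module P -> inj_module P.
Proof.
move=> [m [e eP]] pP.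
pose q : {linear 'rV[R]_m -> P} := free_fun e.
have qS : surj q by move=> x; have [c ->] := eP x; exists (\row_i c i);
  apply: eq_bigr => i _; rewrite mxE.
have [s qs] := pP _ _ q (idfun : {linear P -> P}) qS.
move=> A B d f dinj.
have [g gP] := @inj_free m A B d (s \o f : {linear A -> 'rV[R]_m}) dinj.
by exists (q \o g : {linear B -> P}) => x; rewrite /= gP /= qs.
Qed.
End Kasch.

(** * The functor Phi *)

Section StableImage.
Variables (R : nzRingType) (M : fgMod R -> Prop) (n : nat).
Hypothesis ctM : cluster_tilting M n.
Variable il : functor (mod_cat M) (mod_stab_cat M).
Hypothesis adj : left_adjoint il (incl_stab M).

(** Only the adjunction is known of [il]; its unit is compared with the explicit quotient
    [stab_quot], through which every map to a functor vanishing on projectives factors. *)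
Lemma unit_cover : exists eta : forall F : mod_cat M,
    nattrans (subval F) (subval (subval (il F))),
  [/\ forall F, pointwise_surj (eta F),
      forall F X x, eta F X x = 0 <-> trace x &
      forall F G (a : Defs.hom F G),
        natM (fmap il a : nattrans _ _) (eta F) = natM (eta G) (a : nattrans _ _)].
Proof.
have [phi [phi_bij phi_nat]] := adj.
pose eta (F : mod_cat M) : nattrans (subval F) (subval (subval (il F))) :=
  phi F (il F) (idm _).
have phiE F Y (h : Defs.hom (il F) Y) : phi F Y h = natM (h : nattrans _ _) (eta F).
  have := phi_nat F F (il F) Y (idm F) h (idm (il F)).
  by rewrite fmap1 !compm1.
have desc_eta F : natM (desc ctM (eta F) (subvalP (il F)))
    (quot_proj (trace_sub ctM (subval F))) = eta F.
  by apply: nattrans_ext => X x; exact: (desc_funE ctM (eta F) (subvalP (il F)) x).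
have lift_quot F : exists h : nattrans (subval (subval (il F))) (stab_quot ctM (subval F)),
    natM h (eta F) = quot_proj (trace_sub ctM (subval F)).
  have [g _ gK] := phi_bij F (stab_obj ctM F).
  by exists (g (quot_proj (trace_sub ctM (subval F))));
    exact: etrans (esym (phiE _ _ _)) (gK _).
exists eta; split=> [F X y|F X x|F G a].
- have [h hE] := lift_quot F.
  pose d := desc ctM (eta F) (subvalP (il F)).
  have dh : natM d h = nat1 _.
    apply: (bij_inj (phi_bij F (il F))); rewrite !phiE.
    transitivity (natM d (natM h (eta F))); first exact: nattrans_ext.
    by rewrite hE desc_eta; exact: nattrans_ext.
  have [x qx] := qpi_surj (h X y); exists x.
  rewrite -(desc_eta F) /= qx.
  exact: (congr1 (fun t : nattrans _ _ => t X y) dh).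
- split=> [ex|tx]; last first.
    by apply: (trace_kill (ctM := ctM) _ (subvalP (il F))); exact/zmod_predP.
  have [h hE] := lift_quot F.
  suff : x \in trace_sub ctM (subval F) X by move/zmod_predP.
  apply/qpi_eq0; rewrite -[LHS]/(quot_proj (trace_sub ctM (subval F)) X x) -hE /=.
  by rewrite ex raddf0.
- rewrite -phiE; have := phi_nat F G (il G) (il G) a (idm _) (idm _).
  by rewrite !comp1m.
Qed.

Definition stably_lifts (f : mono M) (X : objM M) (h : {linear X -> mcod f}) : Prop :=
  exists (P : objM M) (a : {linear X -> mdom f}) (g : {linear X -> P})
    (q : {linear P -> mcod f}), proj_module P /\ forall x, h x = f (a x) + q (g x).

(** A trace element of [Upsilon f] comes from a map [q] out of a projective, by lifting along the
    cokernel projection. Below, [Phi f] is used only through this cover. *)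
Lemma Phi_cover : exists p : forall f : mono M,
    nattrans (yo (mcod f)) (subval (subval (Phi il f))),
  [/\ forall f, pointwise_surj (p f),
      forall f X h, p f X h = 0 <-> stably_lifts h &
      forall (f g : mono_cat M) (s : Defs.hom f g),
        natM (fmap (Phi il) s : nattrans _ _) (p f) = natM (p g) (yo_map (sq_cod s))].
Proof.
have [eta [etaS eta0 eta_nat]] := unit_cover.
exists (fun f => natM (eta (subval (upsilon_obj f))) (coker_proj (yo_map f))).
split=> [f X y|f X h|f g s].
- have [z <-] := etaS _ X y; have [w <-] := (coker_exact (yo_map f)).2 X z.
  by exists w.
- apply: (iff_trans (eta0 _ _ _)); split=> [[P [g [y [pP hy]]]]|[P [a [g [q [pP hE]]]]]].
    have [q qy] := (coker_exact (yo_map f)).2 P y.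
    have /((coker_exact (yo_map f)).1 X)[a aE] :
        coker_proj (yo_map f) X (h - Defs.pmap (yo (mcod f)) g q) = 0.
      by rewrite raddfB ncompP qy hy subrr.
    exists P, a, g, q; split=> // x.
    move: (congr1 (fun k : {linear _ -> _} => k x) aE) => /= ->.
    by rewrite subrK.
  exists P, g, (coker_proj (yo_map f) P q); split=> //.
  rewrite -ncompP; apply/eqP; rewrite -subr_eq0 -raddfB; apply/eqP.
  apply/(coker_exact (yo_map f)).1; exists a; apply: linear_ext => x /=.
  by rewrite hE addrK.
- have e := eta_nat _ _ (fmap (Upsilon M) s).
  apply: nattrans_ext => X h.
  apply: (etrans (congr1 (fun t : nattrans _ _ => t X (coker_proj (yo_map f) X h)) e)).
  exact: (congr1 (eta _ X) (upsilon_mapE s h)).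
Qed.

Section Factor.
Variables (F G H : presheaf M) (p : nattrans F G) (q : nattrans F H).
Hypotheses (pS : pointwise_surj p) (pq : forall X x, p X x = 0 -> q X x = 0).

Definition factor_fun X (y : G X) : H X := q X (projT1 (cid (pS y))).

Lemma factor_funE X x : factor_fun (p X x) = q X x.
Proof.
rewrite /factor_fun; case: cid => z /= pz; apply/eqP; rewrite -subr_eq0 -raddfB.
by apply/eqP/pq; rewrite raddfB pz subrr.
Qed.

Lemma factor_additive X : zmod_morphism (@factor_fun X).
Proof.
move=> u v; have [x <-] := pS u; have [y <-] := pS v.
by rewrite -raddfB !factor_funE raddfB.
Qed.
HB.instance Definition _ X := GRing.isZmodMorphism.Build
  (G X) (H X) (@factor_fun X) (@factor_additive X).

Lemma factor_nat (X Y : objM M) (f : {linear X -> Y}) y :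
  factor_fun (Defs.pmap G f y) = Defs.pmap H f (factor_fun y).
Proof. by have [x <-] := pS y; rewrite -ncompP !factor_funE ncompP. Qed.

Definition factor : nattrans G H :=
  NatTrans (F := G) (G := H) (ncomp := fun X => @factor_fun X) factor_nat.
End Factor.

(** * Fullness, density and objectivity *)

Hypothesis embed : forall X : objM M, exists (P : objM M) (j : {linear X -> P}),
  proj_module P /\ injective j.
Hypothesis proj_inj : forall P : objM M, proj_module P -> inj_module P.

Lemma Phi_full : full (Phi il).
Proof.
have [p [pS p0 p_nat]] := Phi_cover; move=> f f' u.
have [t tE] := pS f' (mcod f)
  ((u : nattrans _ _) _ (p f _ (idfun : {linear mcod f -> mcod f}))).
have utE (X : objM M) (h : {linear X -> mcod f}) :
    (u : nattrans _ _) X (p f X h) = p f' X (t \o h : {linear X -> mcod f'}).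
  have -> : h = Defs.pmap (yo (mcod f)) h (idfun : {linear mcod f -> mcod f}).
    exact: linear_ext.
  have -> : (t \o Defs.pmap (yo (mcod f)) h (idfun : {linear mcod f -> mcod f})
      : {linear X -> mcod f'}) = Defs.pmap (yo (mcod f')) h t by exact: linear_ext.
  by rewrite !ncompP tE.
have /p0[P [a [g [q [pP tfE]]]]] : p f' _ (t \o f : {linear mdom f -> mcod f'}) = 0.
  rewrite -utE; suff -> : p f _ (f : {linear mdom f -> mcod f}) = 0 by rewrite raddf0.
  (* Any projective object serves for the zero summand; [embed] supplies one. *)
  have [P [_ [pP _]]] := embed (mdom f).
  by apply/p0; exists P, idfun, 0, 0; split=> // x; rewrite addr0.
have [g' g'E] := proj_inj pP g (@monoP _ _ f).
pose c : {linear mcod f -> mcod f'} := t - (q \o g' : {linear mcod f -> mcod f'}).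
have sq x : c (f x) = f' (a x).
  by rewrite /c /= g'E [t (f x)]tfE addrK.
exists (Square sq); apply: nattrans_ext => X y; have [h <-] := pS f X y.
have := congr1 (fun v : nattrans _ _ => v X h) (p_nat f f' (Square sq)) => /= ->.
rewrite utE; apply/eqP; rewrite -subr_eq0 -raddfB; apply/eqP/p0.
exists P, 0, (g' \o h : {linear X -> P}), (- q); split=> // x /=.
by rewrite raddf0 add0r addrAC subrr add0r.
Qed.

Lemma Phi_dense : dense (Phi il).
Proof.
have [p [pS p0 p_nat]] := Phi_cover; move=> F.
have [A1 [A0 [a [r [ar rS]]]]] := subvalP (subval F).
have F0 := subvalP F.
pose a0 : {linear A1 -> A0} := a A1 (idfun : {linear A1 -> A1}).
have aE (X : objM M) (k : {linear X -> A1}) : a X k = (a0 \o k : {linear X -> A0}).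
  have -> : k = Defs.pmap (yo A1) k (idfun : {linear A1 -> A1}) by exact: linear_ext.
  by rewrite ncompP; exact: linear_ext.
have [I [j [pI jinj]]] := embed A1.
pose m : {linear A1 -> prodM ctM A0 I} := pairl a0 j.
have minj : injective m by move=> x y [_ /jinj].
pose f := Mono minj; exists f.
(* Projecting to [A0] gives an epimorphism onto [F] with the same kernel as [p f], so its target is
   isomorphic to [Phi f]. *)
pose r' := natM r (yo_map (prl A0 I : {linear prodM ctM A0 I -> A0})).
have r'S : pointwise_surj r'.
  move=> X y; have [h <-] := rS X y; exists (pairl h 0).
  by congr (r X _); apply: linear_ext.
have ker (X : objM M) (h : {linear X -> mcod f}) : p f X h = 0 <-> r' X h = 0.
  apply: (iff_trans (p0 f X h)); split=> [[P [k [g [q [pP hE]]]]]|/ar[k kE]].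
    have -> : r' X h = r X (a X k) +
        Defs.pmap (subval (subval F)) g (r P (prl A0 I \o q : {linear P -> A0})).
      rewrite -(ncompP r) -(raddfD (r X)) aE; congr (r X _).
      by apply: linear_ext => x /=; rewrite hE.
    rewrite (F0 P pP (r P _)) raddf0 addr0; apply/ar; by exists k.
  exists I, k, ((prr A0 I \o h) \- (j \o k) : {linear X -> I}), (pairl 0 idfun).
  split=> // x; rewrite aE in kE.
  move: (congr1 (fun v : {linear _ -> _} => v x) kE) => /= kx.
  by apply: injective_projections; rewrite /= ?addr0 // addrC subrK.
have ker1 (X : objM M) h := (ker X h).1; have ker2 (X : objM M) h := (ker X h).2.
pose u := factor (pS f) ker1; pose v := factor r'S ker2.
exists u, v; split; apply: nattrans_ext => X y.
  have [h <-] := pS f X y.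
  exact: etrans (congr1 (v X) (factor_funE (pS f) ker1 h)) (factor_funE r'S ker2 h).
have [h <-] := r'S X y.
exact: etrans (congr1 (u X) (factor_funE r'S ker2 h)) (factor_funE (pS f) ker1 h).
Qed.

Lemma Phi_objective : objective (Phi il).
Proof.
have [p [pS p0 p_nat]] := Phi_cover; move=> f f' s s0.
have /p0[P [a [g [q [pP sE]]]]] : p f' _ (sq_cod s) = 0.
  have e := p_nat f f' s; rewrite s0 in e.
  have := congr1 (fun v : nattrans (yo (mcod f)) _ =>
    v (mcod f) (idfun : {linear mcod f -> mcod f})) e.
  by move=> /= /esym pe; apply: etrans pe; congr (p f' _ _); exact: linear_ext.
have [I [j [pI jinj]]] := embed (mcod f).
pose Q := prodM ctM P I.
have pQ : proj_module Q by exact: prod_proj.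
(* The component [j] makes [g'] injective, so that [m] is a monomorphism. *)
pose g' : {linear mcod f -> Q} := pairl g j.
pose D := prodM ctM (mcod f) (mdom f).
pose E := prodM ctM (mcod f) Q.
pose m : {linear D -> E} := pairl (prl (mcod f) (mdom f)) (g' \o f \o prr (mcod f) (mdom f)).
have minj : injective m.
  by move=> [x x'] [y y'] [-> _ /jinj/(@monoP _ _ f) ->].
pose K := Mono minj.
have s1P x : (pairl idfun g' : {linear mcod f -> mcod K}) (f x) =
    K ((pairl f idfun : {linear mdom f -> mdom K}) x) by [].
pose b1 : {linear mcod K -> mcod f'} :=
  ((f' \o a) \o prl (mcod f) Q) \+ ((q \o prl P I) \o prr (mcod f) Q).
(* The second summand corrects [a] by the defect [sq_dom s - a f], which [f'] sends to [q g f]. *)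
pose b0 : {linear mdom K -> mdom f'} :=
  (a \o prl (mcod f) (mdom f)) \+ ((sq_dom s \- (a \o f)) \o prr (mcod f) (mdom f)).
have s2P x : b1 (K x) = f' (b0 x).
  case: x => x y; rewrite /= raddfD raddfB /=; congr (_ + _).
  by rewrite -squareP sE [X in _ = X - _]addrC addrK.
exists K, (Square s1P), (Square s2P); split.
  apply: square_ext; apply: linear_ext => x /=; last by rewrite sE.
  by rewrite addrC subrK.
have Kz (X : objM M) (x : subval (subval (Phi il K)) X) : x = 0.
  have [h <-] := pS K X x; apply/p0.
  (* The component in [mcod f] lifts through [K] and the other one factors through the projective
     [Q]. *)
  exists Q, (pairl (prl (mcod f) Q \o h) 0), (prr (mcod f) Q \o h : {linear X -> Q}),
    (pairl 0 idfun).
  by split=> // z; apply: injective_projections; rewrite /= ?raddf0 ?addr0 ?add0r.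
move=> Y; split=> u; apply: nattrans_ext => X x.
  by rewrite (Kz X x) raddf0.
by rewrite (Kz X (u X x)).
Qed.
End StableImage.

Theorem theorem3p3p1 (k : comNzRingType) (L : algType k) (n : nat)
    (M : fgMod L -> Prop) :
  artin_algebra L -> self_injective L -> (1 < n)%N -> cluster_tilting M n ->
  forall il : functor (mod_cat M) (mod_stab_cat M),
    left_adjoint il (incl_stab M) ->
    full (Phi il) /\ dense (Phi il) /\ objective (Phi il).
Proof.
move=> /dcc_artin_algebra dL iL _ ctM il adj.
have embed (X : objM M) : exists (P : objM M) (j : {linear X -> P}),
    proj_module P /\ injective j.
  have [m [j jinj]] := embed_free dL iL (fgP X).
  by exists (ObjM (ct_proj ctM (P := FgMod (free_fg L m)) (@free_proj L m))), j;
    split=> //; exact: free_proj.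
have proj_inj (P : objM M) : proj_module P -> inj_module P.
  by apply: inj_proj => //; exact: fgP.
split; first exact: (Phi_full ctM adj embed proj_inj).
split; first exact: (Phi_dense ctM adj embed).
exact: (Phi_objective ctM adj embed).
Qed.
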